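(* Let $\mathsf{k}$ be a commutative ring, $A$ a countable set, $\diamond$ a commutative associative $\mathsf{k}$-bilinear product on $\mathsf{k}A$, $\mathcal{P}$ a commutative $\mathsf{k}$-algebra, $\mathcal{X}=(X,\prec)$ a finite totally ordered set, and $\{f_m\}_{m\in\mathcal{X}}$ a family of $\mathsf{k}$-linear maps $f_m:\mathsf{k}A\to\mathcal{P}$. If, for every $m\in\mathcal{X}$, the map $f_m:(\mathsf{k}A,\diamond)\to\mathcal{P}$ is a $\mathsf{k}$-algebra homomorphism, then the multiple Schur series $F_{\mathcal{X}}$ is a $\mathsf{k}$-algebra homomorphism from $(\mathcal{Y}_\diamond,\ast)$ to $\mathcal{P}$.
   Context: $\mathsf{k}A$ is the free $\mathsf{k}$-module with basis $A$; $(\mathsf{k}A,\diamond)$ need not be unital, and ''$f_m$ is an algebra homomorphism'' means $f_m$ is $\mathsf{k}$-linear with $f_m(x\diamond y)=f_m(x)f_m(y)$. $\mathsf{k}\langle A\rangle$ is the free associative $\mathsf{k}$-algebra on $A$ with basis the words. Tableaux. For partitions $\mu\subseteq\lambda$ (padded by zeros), $D(\lambda/\mu)=\{(i,j):\mu_i<j\le\lambda_i\}$ ($i$ row index increasing downwards, $j$ column index). A Young tableau of shape $\mathrm{sh}(\mathbf h)=\lambda/\mu$ with entries in $A$ is any family $\mathbf h=(h_{i,j})_{(i,j)\in D(\lambda/\mu)}$; $\mathrm{YT}(A)$ is the set of all of them; $\mathbf 1$ is the empty tableau. For $\mathbf h$ of shape $\lambda/\mu$, $\lambda=(\lambda_1,\dots,\lambda_r)$,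 cut $\mathbf h$ after every row $i$ with $\mu_i\ge\lambda_{i+1}$ ($\lambda_{r+1}:=0$); translate each resulting piece up and to the left so that it starts in row $1$ and as far left as possible (a piece without boxes becomes $\mathbf 1$). The resulting multiset is $\mathrm{SC}(\mathbf h)$. $\mathcal{Y}$ (written $\mathsf{k}\boxed{A}$ in the paper) is the commutative algebra $\mathsf{k}[\mathrm{YT}(A)]$ modulo the relations $\mathbf h=\prod_{\mathbf i\in\mathrm{SC}(\mathbf h)}\mathbf i$, with $\mathbf 1$ the unit; its product is $\ast$. Linearization. A skew shape is a horizontal strip if no column contains two boxes. $\mathrm{SSD}(\lambda/\mu)$ is the set of tuples $(D_1,\dots,D_r)$, $D_t=D(\eta^{(t)}/\eta^{(t-1)})$, coming from chains of partitions $\mu=\eta^{(0)}\subsetneq\cdots\subsetneq\eta^{(r)}=\lambda$ with every $\eta^{(t)}/\eta^{(t-1)}$ a horizontal strip. $L_\diamond:\mathcal{Y}\to\mathsf{k}\langle A\rangle$ is the $\mathsf{k}$-linear map $L_\diamond(\mathbf h)=\sum_{(D_1,\dots,D_r)\in\mathrm{SSD}(\mathrm{sh}(\mathbf h))}|\mathbf h_{D_1}|_\diamond\cdots|\mathbf h_{D_r}|_\diamond$ (concatenation), $|\mathbf h_D|_\diamond\in\mathsf{k}A$ being the $\diamond$-product of all $h_{i,j}$, $(i,j)\in D$, and $L_\diamond(\mathbf 1)=\mathbf 1$. It is an algebra homomorphism to $\mathsf{k}\langle A\rangle$ with the quasi-shuffle product associated with $\diamond$, and $\mathcal{Y}_\diamond:=\mathcal{Y}/\ker(L_\diamond)$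 with induced product $\ast$. Multiple Schur series. $\mathrm{SSYT}(\lambda/\mu,\mathcal{X})$ is the set of fillings $(m_{i,j})_{(i,j)\in D(\lambda/\mu)}$ with entries in $X$ such that $m_{i,j}\preceq m_{i,j+1}$ and $m_{i,j}\prec m_{i+1,j}$ whenever both boxes are in $D(\lambda/\mu)$. $F_{\mathcal{X}}$ is given by $F_{\mathcal{X}}(\mathbf h)=\sum_{(m_{i,j})\in\mathrm{SSYT}(\mathrm{sh}(\mathbf h),\mathcal{X})}\prod_{(i,j)\in D(\mathrm{sh}(\mathbf h))}f_{m_{i,j}}(h_{i,j})$, with $F_{\mathcal{X}}(\mathbf 1)=1$; the statement includes that it is well defined on the quotient $\mathcal{Y}_\diamond$. *)

(* Defs.v *)
From HB Require Import structures.
From mathcomp Require Import all_boot all_order all_algebra.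
From mathcomp Require Import generic_quotient ring_quotient sesquilinear.
From mathcomp Require Import finmap monalg.
From mathcomp Require Import zify.
From mathcomp Require Import boolp classical_sets fsbigop.

Set Implicit Arguments.
Unset Strict Implicit.
Unset Printing Implicit Defensive.

Import Order.TTheory GRing.Theory.

Local Open Scope quotient_scope.
Local Open Scope ring_scope.

(* [{ideal_quot I}] comes as a ring only; a quotient of a commutative
   [k]-algebra is again a [k]-algebra. *)
Section IdealQuotientAlgebra.
Context (k : comNzRingType) (R : comAlgType k) (I : idealr R).
Local Notation Q := {ideal_quot I}.

Definition quot_scale (a : k) (x : Q) : Q := \pi_Q (a *: repr x).

Lemma pi_scale a (x : R) : quot_scale a (\pi_Q x) = \pi_Q (a *: x).
Proof.
apply/eqP; rewrite /quot_scale piE Quotient.equivE -scalerBr -mulr_algl.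
by rewrite idealMr // Quotient.idealrBE reprK.
Qed.

Lemma quot_piP (x : Q) : exists y, x = \pi_Q y.
Proof. by exists (repr x); rewrite reprK. Qed.

Lemma quot_scaleA a b (x : Q) :
  quot_scale a (quot_scale b x) = quot_scale (a * b) x.
Proof. by have [y ->] := quot_piP x; rewrite !pi_scale scalerA. Qed.

Lemma quot_scale1 : left_id 1 quot_scale.
Proof. by move=> x; have [y ->] := quot_piP x; rewrite pi_scale scale1r. Qed.

Lemma quot_scaleDr : right_distributive quot_scale +%R.
Proof.
move=> a x y; have [[u ->] [v ->]] := (quot_piP x, quot_piP y).
by rewrite -[_ + _]rmorphD !pi_scale scalerDr rmorphD.
Qed.

Lemma quot_scaleDl (x : Q) : {morph quot_scale^~ x : a b / a + b}.
Proof.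
by move=> a b; have [y ->] := quot_piP x; rewrite !pi_scale scalerDl rmorphD.
Qed.

HB.instance Definition _ := GRing.Zmodule_isLmodule.Build k Q
  quot_scaleA quot_scale1 quot_scaleDr quot_scaleDl.

Lemma quot_scalerAl a (x y : Q) : a *: (x * y) = (a *: x) * y.
Proof.
have [[u ->] [v ->]] := (quot_piP x, quot_piP y).
have pZ z : a *: \pi_Q z = \pi_Q (a *: z) := pi_scale a z.
by rewrite -[_ * _]rmorphM !pZ -[RHS]rmorphM scalerAl.
Qed.

HB.instance Definition _ := GRing.LSemiModule_isLSemiAlgebra.Build k Q
  quot_scalerAl.
HB.instance Definition _ := GRing.Lalgebra_isComAlgebra.Build k Q.

End IdealQuotientAlgebra.

Section Tableaux.
Local Open Scope nat_scope.

Definition is_intpart (la : seq nat) := sorted geq la && (0 \notin la).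

Record intpart := IntPart { parts :> seq nat; _ : is_intpart parts }.
HB.instance Definition _ := [isSub for parts].
HB.instance Definition _ := [Countable of intpart by <:].

Implicit Types la mu : seq nat.

Definition included mu la :=
  all (fun i => nth 0 mu i <= nth 0 la i) (iota 0 (size mu)).

(* Rows and columns are numbered from 0: the pair (i, j) is the box (i+1, j+1)
   of the usual convention. *)
Definition boxes la mu : {fset nat * nat} :=
  [fset b in [seq (i, j) | i <- iota 0 (size la),
                           j <- iota (nth 0 mu i) (nth 0 la i - nth 0 mu i)]]%fset.

Definition skew := {p : intpart * intpart | included p.2 p.1}.
HB.instance Definition _ := Countable.on skew.
Definition outer (s : skew) : intpart := (val s).1.
Definition inner (s : skew) : intpart := (val s).2.

Definition diagram (s : skew) := boxes (outer s) (inner s).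

Definition tableau (A : countType) := {s : skew & {ffun diagram s -> A}}.
HB.instance Definition _ (A : countType) := Choice.on (tableau A).

Lemma mem_boxes la mu i j :
  ((i, j) \in boxes la mu) = (nth 0 mu i <= j < nth 0 la i).
Proof.
rewrite inE /=; apply/allpairsPdep/idP => [[i' [j' [_ + [-> ->]]]]|].
  by rewrite mem_iota; case: ltnP => *; lia.
move=> /andP[hm hl]; exists i, j; split=> //; last by rewrite mem_iota; lia.
by rewrite mem_iota /=; case: ltnP => // ?; move: hl; rewrite nth_default.
Qed.

Lemma included_nth mu la i : included mu la -> nth 0 mu i <= nth 0 la i.
Proof.
move=> /allP h; case: (ltnP i (size mu)) => hi; last by rewrite nth_default.
by apply: h; rewrite mem_iota.
Qed.

Lemma intpart_nth (la : intpart) i j : i <= j -> nth 0 la j <= nth 0 la i.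
Proof.
move=> lij; case: (ltnP j (size la)) => hj; last by rewrite nth_default.
have /andP[sla _] := valP la.
apply: (@sorted_leq_nth _ geq _ _ 0 la sla i j) => //; rewrite ?inE //.
- by move=> x y z /= h1 h2; apply: leq_trans h2 h1.
- exact: leqnn.
- exact: leq_ltn_trans lij hj.
Qed.

(* The rows a, ..., b - 1 of a partition, shifted c columns to the left. *)
Definition cut_rows a b c la :=
  [seq x <- [seq nth 0 la i - c | i <- iota a (b - a)] | 0 < x].

Lemma cut_rows_sorted a b c (la : intpart) :
  sorted geq [seq nth 0 la i - c | i <- iota a (b - a)].
Proof.
apply: (@homo_sorted _ _ _ leq geq) (iota_sorted a (b - a)) => i j /= lij.
by apply/leq_sub2r/intpart_nth.
Qed.

Lemma cut_rows_intpart a b c (la : intpart) : is_intpart (cut_rows a b c la).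
Proof.
rewrite /is_intpart mem_filter ltnn /= andbT.
by apply: sorted_filter (cut_rows_sorted a b c la); apply: rev_trans leq_trans.
Qed.

Lemma nth_filter_gt0 (s : seq nat) i :
  sorted geq s -> nth 0 [seq x <- s | 0 < x] i = nth 0 s i.
Proof.
elim: s i => //= x s IHs i pxs; have [x0|x0] := posnP x; last first.
  by case: i => //= i; apply: IHs; apply: path_sorted pxs.
have s0 y : y \in s -> y = 0.
  move: pxs; rewrite x0 path_sortedE; last first.
    by move=> u v w /= h1 h2; apply: leq_trans h2 h1.
  by case/andP => /allP + _ => /[apply] /=; rewrite leqn0 => /eqP.
rewrite (@eq_in_filter _ _ pred0) => [|y /s0 -> //]; rewrite filter_pred0 nth_nil.
case: i => [|i] /=; first by rewrite x0.
by case: (ltnP i (size s)) => hi; rewrite ?(s0 _ (mem_nth 0 hi)) ?nth_default.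
Qed.

Lemma nth_cut_rows a b c (la : intpart) i :
  nth 0 (cut_rows a b c la) i = if i < b - a then nth 0 la (a + i) - c else 0.
Proof.
rewrite nth_filter_gt0 ?cut_rows_sorted //.
case: ltnP => h; last by rewrite nth_default // size_map size_iota.
by rewrite (nth_map 0) ?size_iota // nth_iota.
Qed.

Lemma cut_rows_included a b c (s : skew) :
  included (cut_rows a b c (inner s)) (cut_rows a b c (outer s)).
Proof.
apply/allP => i _; rewrite !nth_cut_rows; case: ifP => // _.
by apply/leq_sub2r/included_nth; have := valP s.
Qed.

Definition cut_skew a b c (s : skew) : skew :=
  exist _ (IntPart (cut_rows_intpart a b c (outer s)),
           IntPart (cut_rows_intpart a b c (inner s)))
        (cut_rows_included a b c s).

Lemma cut_skew_box a b c s (x : diagram (cut_skew a b c s)) :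
  ((val x).1 + a, (val x).2 + c) \in diagram s.
Proof.
have := valP x; case: (val x) => i j; rewrite !mem_boxes !nth_cut_rows /=.
by case: ifP => // _; rewrite [a + i]addnC; lia.
Qed.

(* The rows a, ..., b - 1 of [h]: [c], the inner part of the last of them, is the
   largest possible shift to the left. *)
Definition piece A (h : tableau A) a b : tableau A :=
  let c := nth 0 (inner (tag h)) b.-1 in
  Tagged (fun s => {ffun diagram s -> A})
    [ffun x : diagram (cut_skew a b c (tag h)) => tagged h [` cut_skew_box x]%fset].

(* A piece without boxes is a single empty row; its zero parts are erased, so it
   becomes the empty tableau. The empty tableau itself has no rows, hence no
   pieces: its relation below identifies it with the unit. *)
Definition SC A (h : tableau A) : seq (tableau A) :=
  let la := outer (tag h) in let mu := inner (tag h) in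
  let cuts := [seq i.+1 | i <- iota 0 (size la) & nth 0 la i.+1 <= nth 0 mu i] in
  pairmap (piece h) 0 cuts.

Definition hstrip la mu :=
  [forall b : boxes la mu, forall b' : boxes la mu,
    ((val b).2 == (val b').2) ==> (b == b')].

(* [etas] lists the partitions of the chain after the initial one, [inner s]. *)
Definition SSD (s : skew) : set (seq {fset nat * nat}) :=
  [set pairmap (fun eta eta' : intpart => boxes eta' eta) (inner s) etas
  | etas in [set etas : seq intpart |
      path (fun eta eta' : intpart => [&& eta != eta', included eta eta' & hstrip eta' eta])
           (inner s) etas
      && (last (inner s) etas == outer s)]]%classic.

Definition is_SSYT (s : skew) d (X : finOrderType d) (m : {ffun diagram s -> X}) :=
  [forall b : diagram s, forall b' : diagram s,
    (val b' == ((val b).1, (val b).2.+1)) ==> (m b <= m b')%O] &&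
  [forall b : diagram s, forall b' : diagram s,
    (val b' == ((val b).1.+1, (val b).2)) ==> (m b < m b')%O].

End Tableaux.

(* k A, k <A> and k[YT(A)] are the free module {malg k[A]}, the algebra
   {malg k[{fmonom A}]} of the free monoid (whose product is concatenation), and
   the algebra {malg k[{cmonom tableau A}]} of the free commutative monoid. *)

Section FreeModule.
Context (k : comNzRingType) (K : choiceType) (V : lmodType k).

Definition mlift (f : K -> V) (x : {malg k[K]}) : V :=
  \sum_(a <- msupp x) x@_a *: f a.

Lemma mliftEw f (d : {fset K}) x :
  (msupp x `<=` d)%fset -> mlift f x = \sum_(a <- d) x@_a *: f a.
Proof.
move=> le; rewrite /mlift (big_fset_incl _ le) // => a _ /mcoeff_outdom ->.
by rewrite scale0r.
Qed.

Lemma mlift_linear f : linear (mlift f).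
Proof.
move=> c x y; pose d := (msupp (c *: x + y) `|` msupp x `|` msupp y)%fset.
rewrite !(@mliftEw f d); first last.
- by rewrite /d -fsetUA fsubsetUl.
- by rewrite /d fsetUAC fsubsetUr.
- by rewrite /d fsubsetUr.
rewrite scaler_sumr -big_split /=; apply: eq_bigr => a _.
by rewrite mcoeffD mcoeffZ scalerDl scalerA.
Qed.

Lemma mliftU f a : mlift f << a >> = f a.
Proof.
by rewrite (mliftEw _ msuppU_le) big_seq_fset1 mcoeffUU scale1r.
Qed.

End FreeModule.

Section GeneratedIdeal.
Context (R : comNzRingType) (T : Type) (g : T -> R).

Definition gen_ideal : {pred R} := fun x =>
  `[< exists s : seq (R * T), x = \sum_(p <- s) p.1 * g p.2 >].

Lemma gen_ideal_closed : 1 \notin gen_ideal -> idealr_closed gen_ideal.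
Proof.
split=> // [|a x y /asboolP[s ->] /asboolP[t ->]].
  by apply/asboolP; exists [::]; rewrite big_nil.
apply/asboolP; exists ([seq (a * p.1, p.2) | p <- s] ++ t).
rewrite big_cat big_map mulr_sumr; congr (_ + _).
by apply: eq_bigr => p _; rewrite mulrA.
Qed.

Lemma gen_ideal_ker (S : comNzRingType) (phi : {rmorphism R -> S}) x :
  (forall t, phi (g t) = 0) -> x \in gen_ideal -> phi x = 0.
Proof.
move=> g0 /asboolP[s ->]; rewrite rmorph_sum big1 // => p _.
by rewrite rmorphM g0 mulr0.
Qed.

End GeneratedIdeal.

Section TableauAlgebra.
Context (k : comNzRingType) (A : countType).
Local Notation tab_poly := {malg k[{cmonom tableau A}]}.

Definition tab_gen (h : tableau A) : tab_poly := << ucm h >>.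

Definition SC_rel (h : tableau A) : tab_poly :=
  tab_gen h - \prod_(i <- SC h) tab_gen i.

(* The algebra morphism sending every tableau to 1, used to see that the
   quotients below are not trivial. *)
Definition one_cmonom (m : {cmonom tableau A}) : k := 1.
Fact one_cmonom_mmorphism : mmorphism one_cmonom.
Proof. by split=> // x y; rewrite mulr1. Qed.
HB.instance Definition _ := isMultiplicative.Build _ _ _ one_cmonom_mmorphism.

Definition aug : {lrmorphism tab_poly -> k | *%R} := mmap idfun one_cmonom.

Lemma aug_gen h : aug (tab_gen h) = 1.
Proof. by rewrite [LHS]mmapU mulr1. Qed.

Lemma aug_rel h : aug (SC_rel h) = 0.
Proof.
rewrite rmorphB rmorph_prod [X in X - _]aug_gen.
by rewrite (eq_bigr (fun=> 1) (fun i _ => aug_gen i)) big1_eq subrr.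
Qed.

Definition SC_ideal := gen_ideal SC_rel.
Fact SC_ideal_closed : idealr_closed SC_ideal.
Proof.
apply: gen_ideal_closed; apply/negP => /(gen_ideal_ker aug_rel)/eqP.
by rewrite rmorph1 oner_eq0.
Qed.
HB.instance Definition _ := isIdealr.Build _ SC_ideal SC_ideal_closed.

Local Notation tab_alg := {ideal_quot SC_ideal}.

Definition tab_cls (h : tableau A) : tab_alg := \pi_tab_alg (tab_gen h).

End TableauAlgebra.

Notation tab_alg k A := {ideal_quot (@SC_ideal k A)}.

Section Linearization.
Context (k : comNzRingType) (A : countType).
Local Notation kA := {malg k[A]}.
Local Notation kW := {malg k[{fmonom A}]}.
Variable diam : kA -> kA -> kA.

Definition letters : kA -> kW := mlift (fun a => << fmu a >>).

Fixpoint qsh_word (u : seq A) : seq A -> kW :=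
  if u is a :: u' then
    fix qsh_u (v : seq A) : kW :=
      if v is b :: v' then
        letters << a >> * qsh_word u' v + letters << b >> * qsh_u v'
        + letters (diam << a >> << b >>) * qsh_word u' v'
      else << FMonom u >>
  else fun v => << FMonom v >>.

(* The quasi-shuffle product associated with [diam]. *)
Definition qsh (x y : kW) : kW :=
  mlift (fun u : {fmonom A} => mlift (fun v : {fmonom A} => qsh_word u v) y) x.

(* Only used on non-empty sequences, strips having at least one box. *)
Definition diam_prod (s : seq kA) : kA :=
  if s is x :: s' then foldl diam x s' else 0.

Definition strip_prod (h : tableau A) (D : {fset nat * nat}) : kA :=
  diam_prod [seq << tagged h b >> | b <- enum {: diagram (tag h)} & val b \in D].

Definition linearize (h : tableau A) : kW :=
  \sum_(Ds \in SSD (tag h)) \prod_(D <- Ds) letters (strip_prod h D).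

Record qsh_morphism := QshMorphism {
  qsh_fun :> {linear tab_alg k A -> kW};
  qsh_morphism1 : qsh_fun 1 = 1;
  qsh_morphismM : forall x y, qsh_fun (x * y) = qsh (qsh_fun x) (qsh_fun y) }.

Lemma qshZ (a b : k) : qsh (a *: 1) (b *: 1) = (a * b) *: 1.
Proof.
rewrite /qsh (scalable_linear (mlift_linear _)) mliftU.
by rewrite (scalable_linear (mlift_linear _)) mliftU [LHS]scalerA fm1 /= -fmoneE.
Qed.

Lemma qsh0 x : qsh x 0 = 0.
Proof. by rewrite /qsh /mlift msupp0 big1 // => u _; rewrite big_nil scaler0. Qed.

Definition aug_quot (x : tab_alg k A) : kW := aug k A (repr x) *: 1.

Lemma aug_quotE x : aug_quot (\pi_(tab_alg k A) x) = aug k A x *: 1.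
Proof.
congr (_ *: _); apply/eqP; rewrite -subr_eq0 -rmorphB; apply/eqP.
apply: (gen_ideal_ker (@aug_rel k A)).
have := Quotient.idealrBE (@SC_ideal k A) (repr (\pi_(tab_alg k A) x)) x.
by rewrite reprK eqxx.
Qed.

Fact aug_quot_linear : linear aug_quot.
Proof.
move=> a x y; have [[u ->] [v ->]] := (quot_piP x, quot_piP y).
have -> : a *: \pi_(tab_alg k A) u = \pi_(tab_alg k A) (a *: u) := pi_scale _ a u.
by rewrite -[_ + _]rmorphD !aug_quotE linearP scalerDl scalerA.
Qed.
HB.instance Definition _ :=
  GRing.isLinear.Build k (tab_alg k A) kW _ aug_quot aug_quot_linear.

Fact aug_quot1 : aug_quot 1 = 1.
Proof. by rewrite -[1](rmorph1 (\pi_(tab_alg k A))) aug_quotE rmorph1 scale1r. Qed.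

Fact aug_quotM x y : aug_quot (x * y) = qsh (aug_quot x) (aug_quot y).
Proof.
have [[u ->] [v ->]] := (quot_piP x, quot_piP y).
by rewrite -[_ * _]rmorphM !aug_quotE rmorphM qshZ.
Qed.

(* The linearization map is described by its values on tableaux, which span
   [tab_alg k A], among the algebra morphisms to k<A> with the quasi-shuffle
   product. When [diam] is bilinear, commutative and associative such a morphism
   exists; the other branch is a junk value. *)
Definition linearization : qsh_morphism :=
  if pselect (exists L : qsh_morphism, forall h, L (tab_cls k h) = linearize h)
  is left exL then sval (cid exL) else QshMorphism aug_quot1 aug_quotM.

Definition ker_linearization : {pred tab_alg k A} :=
  fun x => linearization x == 0.

Fact ker_linearization_closed : idealr_closed ker_linearization.
Proof.
split=> [||a x y /eqP Lx /eqP Ly]; rewrite /in_mem /= /ker_linearization.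
- by rewrite linear0.
- by rewrite qsh_morphism1 oner_eq0.
- by rewrite linearD qsh_morphismM Lx Ly qsh0 addr0.
Qed.
HB.instance Definition _ :=
  isIdealr.Build _ ker_linearization ker_linearization_closed.

End Linearization.

(* The quotient of [tab_alg k A] by the kernel of the linearization map. *)
Notation lin_alg diam := {ideal_quot (ker_linearization diam)}.

Section Schur.
Context (k : comNzRingType) (A : countType).
Variable diam : {malg k[A]} -> {malg k[A]} -> {malg k[A]}.

Definition lin_cls (h : tableau A) : lin_alg diam :=
  \pi_(lin_alg diam) (tab_cls k h).

Definition schur (P : comAlgType k) d (X : finOrderType d)
    (f : X -> {linear {malg k[A]} -> P}) (h : tableau A) : P :=
  \sum_(m : {ffun diagram (tag h) -> X} | is_SSYT m)
    \prod_(b : diagram (tag h)) f (m b) << tagged h b >>.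

End Schur.

(* Main.v *)
(** Let L be the linearization map. Splitting off the first strip of a chain gives
    L(D) = sum over the non-empty strips S of D of |h_S| L(D \ S). When D is the
    union of two parts without adjacent boxes, a strip of D is a pair of strips of
    the parts, not both empty; this is the recursion of the quasi-shuffle product,
    so L(D) is the quasi-shuffle product of the two values, and L respects the
    relations between a tableau and its pieces.

    Evaluating the word a_1 ... a_n as the sum of f_{m_1}(a_1) ... f_{m_n}(a_n) over
    m_1 < ... < m_n is a morphism from the quasi-shuffle algebra to P, because every
    f_m is one. In a semistandard filling the boxes containing the least letter form
    a strip, so the Schur sum satisfies the recursion of the evaluation of L. Hence F
    is this evaluation composed with L, which is multiplicative and vanishes on the
    kernel of L. It is unique because a product of tableaux has the same
    linearization as a single tableau, in which they are stacked. *)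

Require Import Defs.
From HB Require Import structures.
From mathcomp Require Import all_boot all_order all_algebra.
From mathcomp Require Import generic_quotient ring_quotient sesquilinear.
From mathcomp Require Import finmap monalg zify.
From mathcomp Require Import boolp classical_sets fsbigop.

Set Implicit Arguments.
Unset Strict Implicit.
Unset Printing Implicit Defensive.

Import Order.TTheory GRing.Theory.
Local Open Scope ring_scope.

(** * Linear maps and the quasi-shuffle product *)

Lemma malg_lin_ind (k : comNzRingType) (K : choiceType)
    (Pr : {malg k[K]} -> Prop) :
    Pr 0 -> (forall c x y, Pr x -> Pr y -> Pr (c *: x + y)) ->
    (forall a, Pr << a >>) ->
  forall x, Pr x.
Proof.
move=> P0 PD P1 x; rewrite [x]monalgE; apply: (big_ind Pr) => // [u v Pu Pv|a _].
  by rewrite -[u]scale1r; apply: PD.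
have -> : << x@_a *g a >> = x@_a *: (<< a >> : {malg k[K]}) + 0.
  rewrite addr0; apply/malgP => b.
  by rewrite mcoeffZ !mcoeffU; case: eqP => _; rewrite ?mulr1 ?mulr0.
exact: PD.
Qed.

Section Linear.
Context (k : comNzRingType).

(** A bare proposition rather than a structure, so that it applies directly to composites and to
    partial applications such as [q^~ y]. *)
Definition plinear (U V : lmodType k) (f : U -> V) :=
  forall c x y, f (c *: x + y) = c *: f x + f y.

Lemma plinear0 (U V : lmodType k) (f : U -> V) : plinear f -> f 0 = 0.
Proof. by move=> fl; rewrite -[0](addNr 0) -scaleN1r fl scaleN1r addNr. Qed.

Lemma plinearD (U V : lmodType k) (f : U -> V) x y :
  plinear f -> f (x + y) = f x + f y.
Proof. by move=> fl; rewrite -[x]scale1r fl !scale1r. Qed.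

Lemma plinearZ (U V : lmodType k) (f : U -> V) c x :
  plinear f -> f (c *: x) = c *: f x.
Proof. by move=> fl; rewrite -[c *: x]addr0 fl (plinear0 fl) addr0. Qed.

Lemma plinear_sum (U V : lmodType k) (f : U -> V) (I : Type) (r : seq I)
    (Pr : pred I) F :
  plinear f -> f (\sum_(i <- r | Pr i) F i) = \sum_(i <- r | Pr i) f (F i).
Proof.
move=> fl; elim/big_rec2: _ => [|i x y _ <-]; first exact: plinear0.
exact: plinearD.
Qed.

Lemma plinear_comp (U V Z : lmodType k) (g : V -> Z) (f : U -> V) :
  plinear g -> plinear f -> plinear (g \o f).
Proof. by move=> gl fl c x y; rewrite /= fl gl. Qed.

Lemma plinear_add (U V : lmodType k) (f g : U -> V) :
  plinear f -> plinear g -> plinear (fun x => f x + g x).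
Proof. by move=> fl gl c x y; rewrite fl gl scalerDr addrACA. Qed.

(** Generation of [U] by the [B i], encoded as an induction principle. *)
Definition spans (U : lmodType k) (I : Type) (B : I -> U) :=
  forall (Pr : U -> Prop), Pr 0 ->
    (forall c x y, Pr x -> Pr y -> Pr (c *: x + y)) -> (forall i, Pr (B i)) ->
  forall x, Pr x.

Lemma plinear_ext (U V : lmodType k) I (B : I -> U) (f g : U -> V) :
  spans B -> plinear f -> plinear g -> (forall i, f (B i) = g (B i)) ->
  forall x, f x = g x.
Proof.
move=> Bs fl gl fg; apply: Bs => // [|c x y IHx IHy].
  by rewrite !plinear0.
by rewrite fl gl IHx IHy.
Qed.

End Linear.

(* [U], [V], [e a], [W u] and [cns x p] stand for kA, k<A>, a letter, a word and the
   concatenation of [x] and [p]. They are kept abstract because unification is very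
   slow on {malg k[A]} and {malg k[{fmonom A}]}. *)
Section AbstractQuasiShuffle.
Context (k : comNzRingType) (U V : lmodType k) (A : Type).
Context (e : A -> U) (W : seq A -> V) (cns : U -> V -> V).
Context (dm : U -> U -> U) (q : V -> V -> V).
Local Notation one := (W [::]).
Hypotheses (spanU : spans e) (spanV : spans W).
Hypotheses (cns_l : forall p, plinear (cns^~ p)) (cns_r : forall x, plinear (cns x)).
Hypotheses (dm_l : forall y, plinear (dm^~ y)) (dm_r : forall x, plinear (dm x)).
Hypotheses (q_l : forall y, plinear (q^~ y)) (q_r : forall x, plinear (q x)).
Hypothesis W_cons : forall a u, W (a :: u) = cns (e a) (W u).
Hypotheses (q1W : forall v, q one (W v) = W v) (qW1 : forall u, q (W u) one = W u).
Hypothesis q_consW : forall a u b v, q (W (a :: u)) (W (b :: v)) =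
  cns (e a) (q (W u) (W (b :: v))) + cns (e b) (q (W (a :: u)) (W v))
  + cns (dm (e a) (e b)) (q (W u) (W v)).

Lemma qsh_abs1l y : q one y = y.
Proof. by move: y; apply: (@plinear_ext k V V _ W _ _ spanV) => // c x y. Qed.

Lemma qsh_abs1r x : q x one = x.
Proof. by apply: (plinear_ext spanV (q_l one)) x => // c x y. Qed.

(** Both sides are linear in each of the four arguments, so the recursion known for words extends to
    arbitrary elements. *)
Lemma qsh_abs_cons x y p r :
  q (cns x p) (cns y r) =
    cns x (q p (cns y r)) + cns y (q (cns x p) r) + cns (dm x y) (q p r).
Proof.
move: x; apply: (@plinear_ext k U V _ e _ _ spanU) => [||a].
- exact: plinear_comp (q_l _) (cns_l p).
- apply: plinear_add; first apply: plinear_add.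
  + exact: cns_l.
  + exact: plinear_comp (cns_r y) (plinear_comp (q_l r) (cns_l p)).
  + exact: plinear_comp (cns_l _) (dm_l y).
move: y; apply: (@plinear_ext k U V _ e _ _ spanU) => [||b].
- exact: plinear_comp (q_r _) (cns_l r).
- apply: plinear_add; first apply: plinear_add.
  + exact: plinear_comp (cns_r _) (plinear_comp (q_r p) (cns_l r)).
  + exact: cns_l.
  + exact: plinear_comp (cns_l _) (dm_r _).
move: p; apply: (@plinear_ext k V V _ W _ _ spanV) => [||u].
- exact: plinear_comp (q_l _) (cns_r _).
- apply: plinear_add; first apply: plinear_add.
  + exact: plinear_comp (cns_r _) (q_l _).
  + exact: plinear_comp (cns_r _) (plinear_comp (q_l _) (cns_r _)).
  + exact: plinear_comp (cns_r _) (q_l _).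
move: r; apply: (@plinear_ext k V V _ W _ _ spanV) => [||v].
- exact: plinear_comp (q_r _) (cns_r _).
- apply: plinear_add; first apply: plinear_add.
  + exact: plinear_comp (cns_r _) (plinear_comp (q_r _) (cns_r _)).
  + exact: plinear_comp (cns_r _) (q_r _).
  + exact: plinear_comp (cns_r _) (q_r _).
by rewrite -!W_cons q_consW.
Qed.

Hypotheses (dmC : commutative dm) (dmA : associative dm).

Lemma qsh_absC : commutative q.
Proof.
move=> x y; move: x; apply: (@plinear_ext k V V _ W _ _ spanV) => // u.
move: y; apply: (@plinear_ext k V V _ W _ _ spanV) => // v.
elim: u v => [|a u IHu] v; first by rewrite q1W qW1.
elim: v => [|b v IHv]; first by rewrite q1W qW1.
by rewrite !q_consW IHu IHv [q (W u) _]IHu dmC [cns (e a) _ + _]addrC.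
Qed.

(** Nested induction on the three words. By the recursion each side splits into seven terms, one for
    every non-empty set of words whose first letters are merged into the leading letter; equal
    leading letters are matched by an induction hypothesis. *)
Lemma qsh_absA : associative q.
Proof.
move=> x y z; move: x; apply: (@plinear_ext k V V _ W _ _ spanV) => [//||u].
  exact: plinear_comp (q_l _) (q_l _).
move: y; apply: (@plinear_ext k V V _ W _ _ spanV) => [||v].
- exact: plinear_comp (q_r _) (q_l _).
- exact: plinear_comp (q_l _) (q_r _).
move: z; apply: (@plinear_ext k V V _ W _ _ spanV) => [|//|w].
  exact: plinear_comp (q_r _) (q_r _).
elim: u v w => [|a u IHu] v w; first by rewrite !qsh_abs1l.
elim: v w => [|b v IHv] w; first by rewrite qsh_abs1l qsh_abs1r.
elim: w => [|c w IHw]; first by rewrite !qsh_abs1r.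
set au := W (a :: u); set bv := W (b :: v); set cw := W (c :: w).
have lD x' y' z' : q (x' + y') z' = q x' z' + q y' z'
    by exact: (plinearD x' y' (q_l z')).
have rD x' y' z' : q x' (y' + z') = q x' y' + q x' z'
    by exact: (plinearD y' z' (q_r x')).
have cD x' y' z' : cns x' (y' + z') = cns x' y' + cns x' z'
    by exact: (plinearD y' z' (cns_r x')).
have auE : au = cns (e a) (W u) by apply: W_cons.
have bvE : bv = cns (e b) (W v) by apply: W_cons.
have cwE : cw = cns (e c) (W w) by apply: W_cons.
have rE : q bv cw = cns (e b) (q (W v) cw) + cns (e c) (q bv (W w))
                    + cns (dm (e b) (e c)) (q (W v) (W w)) by apply: q_consW.
have lE : q au bv = cns (e a) (q (W u) bv) + cns (e b) (q au (W v))
                    + cns (dm (e a) (e b)) (q (W u) (W v)) by apply: q_consW.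
have -> : q au (q bv cw) =
    cns (e a) (q (W u) (q bv cw)) +
    (cns (e b) (q au (q (W v) cw)) + cns (dm (e a) (e b)) (q (W u) (q (W v) cw))) +
    (cns (e c) (q au (q bv (W w))) + cns (dm (e a) (e c)) (q (W u) (q bv (W w)))) +
    (cns (dm (e b) (e c)) (q au (q (W v) (W w)))
      + cns (dm (dm (e a) (e b)) (e c)) (q (W u) (q (W v) (W w)))).
  (* The right factors are now letters followed by products, not words, so the linear form of the
     recursion is required. *)
  rewrite rE !rD !cD auE !qsh_abs_cons -auE -dmA !addrA.
  by rewrite [LHS](ACl (1*4*7*2*3*5*6*8*9)%AC).
have -> : q (q au bv) cw =
    cns (e c) (q (q au bv) (W w)) +
    (cns (e a) (q (q (W u) bv) cw) + cns (dm (e a) (e c)) (q (q (W u) bv) (W w))) +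
    (cns (e b) (q (q au (W v)) cw) + cns (dm (e b) (e c)) (q (q au (W v)) (W w))) +
    (cns (dm (e a) (e b)) (q (q (W u) (W v)) cw)
      + cns (dm (dm (e a) (e b)) (e c)) (q (q (W u) (W v)) (W w))).
  rewrite lE !lD !cD cwE !qsh_abs_cons -cwE [dm (e b) (e c)]dmC.
  rewrite !addrA.
  by rewrite [LHS](ACl (2*5*8*1*3*4*6*7*9)%AC).
rewrite !IHu !IHv IHw !addrA.
by rewrite [LHS](ACl (4*1*5*2*6*3*7)%AC).
Qed.

End AbstractQuasiShuffle.

(** * The quasi-shuffle algebra on words *)

Section QuasiShuffle.
Context (k : comNzRingType) (A : countType).
Local Notation kA := {malg k[A]}.
Local Notation kW := {malg k[{fmonom A}]}.
Variable diam : {bilinear kA -> kA -> kA}.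

Definition letter (a : A) : kA := << a >>.
Definition word (u : seq A) : kW := << FMonom u >>.
Definition cons_word (x : kA) (p : kW) : kW := letters x * p.

Lemma spans_letter : spans letter.
Proof. exact: malg_lin_ind. Qed.

Lemma spans_word : spans word.
Proof.
move=> Pr P0 PD P1; apply: malg_lin_ind => // u.
by have := P1 u; rewrite /word fmK.
Qed.

Lemma word_nil : word [::] = 1.
Proof. by rewrite /word -fmoneE. Qed.

Lemma cons_word_linl p : plinear (cons_word^~ p).
Proof. by move=> c x y; rewrite /cons_word /letters mlift_linear mulrDl -scalerAl. Qed.

(** Scalars are multiples of the empty word, which commutes with every word. *)
Lemma malg_scaleAr c (p r : kW) : p * (c *: r) = c *: (p * r).
Proof.
rewrite -(mul_malgC c r) -(mul_malgC c (p * r)) [LHS](@mulrA kW) [RHS](@mulrA kW).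
apply: (congr1 (fun s => s * r)).
rewrite !malgM_def fgmulgU fgmulUg; apply: eq_bigr => u _.
by rewrite mulrC mul1m mulm1.
Qed.

Lemma cons_word_linr x : plinear (cons_word x).
Proof. by move=> c p r; rewrite /cons_word mulrDr malg_scaleAr. Qed.

Lemma word_cons a u : word (a :: u) = cons_word (letter a) (word u).
Proof.
rewrite /cons_word /letters mliftU malgM_def fgmulUU mulr1.
by congr << _ >>; apply/eqP; rewrite fmP fmM fmU.
Qed.

Lemma mlift_plinear (K : choiceType) (V : lmodType k) (f : K -> V) :
  plinear (mlift f).
Proof. exact: mlift_linear. Qed.

Lemma mlift_plinear_arg (K : choiceType) (V Z : lmodType k) (f : K -> V -> Z) x :
  (forall a, plinear (f a)) -> plinear (fun v => mlift (f^~ v) x).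
Proof.
move=> fl c v w; rewrite /mlift scaler_sumr -big_split; apply: eq_bigr => a _.
by rewrite /= fl scalerDr !scalerA mulrC.
Qed.

Lemma qsh_linl y : plinear (fun x => qsh diam x y).
Proof. exact: mlift_plinear. Qed.

Lemma qsh_linr x : plinear (qsh diam x).
Proof. by apply: mlift_plinear_arg => u; apply: mlift_plinear. Qed.

Lemma qsh_wordE u v : qsh diam (word u) (word v) = qsh_word diam u v.
Proof. by rewrite /qsh !mliftU. Qed.

Lemma qsh_1word v : qsh diam (word [::]) (word v) = word v.
Proof. by rewrite qsh_wordE. Qed.

Lemma qsh_word1 u : qsh diam (word u) (word [::]) = word u.
Proof. by rewrite qsh_wordE; case: u. Qed.

Lemma qsh_cons_word a u b v : qsh diam (word (a :: u)) (word (b :: v)) =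
  cons_word (letter a) (qsh diam (word u) (word (b :: v)))
  + cons_word (letter b) (qsh diam (word (a :: u)) (word v))
  + cons_word (diam (letter a) (letter b)) (qsh diam (word u) (word v)).
Proof. by rewrite !qsh_wordE. Qed.

Lemma diam_linl y : plinear (fun x => diam x y).
Proof. by move=> c x x'; rewrite linearPl. Qed.

Lemma diam_linr x : plinear (diam x).
Proof. by move=> c y y'; rewrite linearPr. Qed.

Lemma qsh1l y : qsh diam 1 y = y.
Proof. by rewrite -word_nil; apply: (qsh_abs1l spans_word qsh_linr qsh_1word). Qed.

Lemma qsh_cons x y p r :
  qsh diam (cons_word x p) (cons_word y r) =
    cons_word x (qsh diam p (cons_word y r))
    + cons_word y (qsh diam (cons_word x p) r)
    + cons_word (diam x y) (qsh diam p r).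
Proof.
exact: (qsh_abs_cons spans_letter spans_word cons_word_linl cons_word_linr
  diam_linl diam_linr qsh_linl qsh_linr word_cons qsh_cons_word).
Qed.

Hypothesis diamC : commutative diam.
Hypothesis diamA : associative diam.

Lemma qshC : commutative (qsh diam).
Proof.
exact: (qsh_absC spans_word qsh_linl qsh_linr qsh_1word qsh_word1
  qsh_cons_word diamC).
Qed.

Lemma qshA : associative (qsh diam).
Proof.
exact: (qsh_absA spans_letter spans_word cons_word_linl cons_word_linr
  diam_linl diam_linr qsh_linl qsh_linr word_cons qsh_1word qsh_word1
  qsh_cons_word diamC diamA).
Qed.

(* The [k]-module k<A> with the quasi-shuffle product as its multiplication. *)
Definition qsh_alg of commutative diam & associative diam := kW.

Local Notation qA := (qsh_alg diamC diamA).
HB.instance Definition _ := GRing.Lmodule.on qA.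

Lemma qsh_oner_neq0 : (1 : kW) != 0.
Proof. exact: oner_neq0. Qed.

Lemma qshDl : left_distributive (qsh diam) +%R.
Proof. by move=> x y z; apply: (plinearD x y (qsh_linl z)). Qed.

HB.instance Definition _ := GRing.Zmodule_isComNzRing.Build qA
  qshA qshC qsh1l qshDl qsh_oner_neq0.

Lemma qshZl a (x y : kW) : a *: qsh diam x y = qsh diam (a *: x) y.
Proof. by rewrite (plinearZ a x (qsh_linl y)). Qed.

Lemma qsh_scalerAl a (x y : qA) : a *: (x * y) = @GRing.mul qA (a *: x) y.
Proof. exact: qshZl. Qed.

HB.instance Definition _ := GRing.LSemiModule_isLSemiAlgebra.Build k qA
  qsh_scalerAl.
HB.instance Definition _ := GRing.Lalgebra_isComAlgebra.Build k qA.

End QuasiShuffle.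

(** * Strips and linearization of labelled sets of boxes *)

Section Strips.
Context (T : choiceType) (wk st : rel T).
Implicit Types (D S : {fset T}).
Local Open Scope fset_scope.

(* [wk] and [st] are the pairs of boxes whose entries must increase weakly and
   strictly. In a skew diagram, the strips are the horizontal strips whose removal
   leaves a skew diagram with the same outer shape. *)
Definition strip D S : bool :=
  (S `<=` D) &&
  all (fun b => all (fun b' => (wk b' b ==> (b' \in S)) && ~~ st b' b) D) S.

Lemma stripP D S : reflect
  (S `<=` D /\ forall b b', b \in S -> b' \in D -> (wk b' b -> b' \in S) /\ ~~ st b' b)
  (strip D S).
Proof.
apply: (iffP andP) => [[sSD /allP h]|[sSD h]]; split=> //.
  by move=> b b' bS b'D; have /allP/(_ _ b'D)/andP[/implyP] := h _ bS.
apply/allP => b bS; apply/allP => b' b'D; have [h1 h2] := h _ _ bS b'D.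
by rewrite h2 andbT; apply/implyP.
Qed.

Lemma strip_sub D S : strip D S -> S `<=` D.
Proof. by case/andP. Qed.

Lemma strip0 D : strip D fset0.
Proof. by apply/stripP; split=> [|b b']; rewrite ?fsub0set ?inE. Qed.

Definition strips D : seq {fset T} := [seq Y <- fpowerset D | strip D Y].
Definition nstrips D : seq {fset T} := [seq Y <- strips D | Y != fset0].

Lemma mem_strips D S : (S \in strips D) = strip D S.
Proof.
rewrite mem_filter; have [/strip_sub sSD|//] := boolP (strip D S).
by rewrite fpowersetE.
Qed.

Lemma mem_nstrips D S : (S \in nstrips D) = strip D S && (S != fset0).
Proof. by rewrite mem_filter mem_strips andbC. Qed.

Lemma uniq_strips D : uniq (strips D).
Proof. exact/filter_uniq/fset_uniq. Qed.

Lemma uniq_nstrips D : uniq (nstrips D).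
Proof. exact/filter_uniq/uniq_strips. Qed.

Lemma perm_strips D : perm_eq (strips D) (fset0 :: nstrips D).
Proof.
apply: uniq_perm; first exact: uniq_strips.
  by rewrite /= uniq_nstrips mem_nstrips eqxx andbF.
move=> S; rewrite inE mem_nstrips mem_strips.
by have [->|] := eqVneq S fset0; rewrite ?strip0 ?andbT.
Qed.

(** The relative position of two pieces separated by a cut, and of two stacked tableaux. *)
Definition unrelated D1 D2 := forall b b', b \in D1 -> b' \in D2 ->
  [/\ b != b', ~~ wk b b', ~~ wk b' b, ~~ st b b' & ~~ st b' b].

Lemma unrelatedC D1 D2 : unrelated D1 D2 -> unrelated D2 D1.
Proof. by move=> h b b' bD b'D; have [] := h _ _ b'D bD; rewrite eq_sym. Qed.

Lemma unrelatedS D1 D2 S1 S2 :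
  S1 `<=` D1 -> S2 `<=` D2 -> unrelated D1 D2 -> unrelated S1 S2.
Proof. by move=> /fsubsetP s1 /fsubsetP s2 h b b' /s1 + /s2; apply: h. Qed.

Lemma unrelated_disjoint D1 D2 b : unrelated D1 D2 -> b \in D1 -> b \in D2 -> false.
Proof. by move=> h b1 b2; have [] := h b b b1 b2; rewrite eqxx. Qed.

Section Split.
Variables (D1 D2 : {fset T}).
Hypothesis D12 : unrelated D1 D2.

Lemma stripU_l S1 S2 : S1 `<=` D1 -> S2 `<=` D2 ->
  strip (D1 `|` D2) (S1 `|` S2) -> strip D1 S1.
Proof.
move=> /fsubsetP s1 /fsubsetP s2 /stripP[_ h]; apply/stripP.
split=> [|b b' bS b'D]; first exact/fsubsetP.
have [||h1 h2] := h b b'; rewrite ?inE ?bS ?b'D //; split=> // /h1.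
rewrite inE => /orP[//|/s2 b'D2].
by have := unrelated_disjoint D12 b'D b'D2.
Qed.

Lemma stripU_intro S1 S2 : strip D1 S1 -> strip D2 S2 -> strip (D1 `|` D2) (S1 `|` S2).
Proof.
move=> /stripP[s1 h1] /stripP[s2 h2]; apply/stripP.
split=> [|b b']; first exact: fsetUSS.
have t1 := fsubsetP s1; have t2 := fsubsetP s2.
rewrite !inE => /orP[bS|bS] /orP[b'D|b'D].
- by have [h ->] := h1 _ _ bS b'D; split=> // /h ->.
- by have [_ _ /negPf -> _ ->] := D12 (t1 _ bS) b'D.
- by have [_ /negPf -> _ -> _] := D12 b'D (t2 _ bS).
- by have [h ->] := h2 _ _ bS b'D; split=> // /h ->; rewrite orbT.
Qed.

Lemma fsubsetU_split S : S `<=` D1 `|` D2 -> S = (S `&` D1) `|` (S `&` D2).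
Proof. by move=> sS; rewrite -fsetIUr; apply/esym/fsetIidPl. Qed.

Lemma fsetU_splitl S1 S2 : S1 `<=` D1 -> S2 `<=` D2 -> (S1 `|` S2) `&` D1 = S1.
Proof.
move=> /fsubsetP s1 /fsubsetP s2; apply/fsetP => b; rewrite !inE.
have [/s1 ->//|_ /=] := boolP (b \in S1).
have [/s2 b2|//] := boolP (b \in S2).
by apply/negP => b1; have := unrelated_disjoint D12 b1 b2.
Qed.

Lemma fsetU_splitr S1 S2 : S1 `<=` D1 -> S2 `<=` D2 -> (S1 `|` S2) `&` D2 = S2.
Proof.
move=> /fsubsetP s1 /fsubsetP s2; apply/fsetP => b; rewrite !inE.
have [/s2 -> /=|_ /=] := boolP (b \in S2); first by rewrite orbT.
have [/s1 b1|//] := boolP (b \in S1).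
by apply/negP => b2; have := unrelated_disjoint D12 b1 b2.
Qed.

End Split.

Lemma stripU_r D1 D2 S1 S2 : unrelated D1 D2 -> S1 `<=` D1 -> S2 `<=` D2 ->
  strip (D1 `|` D2) (S1 `|` S2) -> strip D2 S2.
Proof.
move=> D12 s1 s2; rewrite fsetUC [S1 `|` _]fsetUC.
exact: (stripU_l (unrelatedC D12)).
Qed.

(** A strip of the union is determined by its traces on the two parts, which are strips not both
    empty. The three blocks correspond to the three terms of the quasi-shuffle recursion. *)
Lemma perm_nstripsU D1 D2 : unrelated D1 D2 ->
  perm_eq (nstrips (D1 `|` D2))
    (nstrips D1 ++ nstrips D2 ++ [seq S1 `|` S2 | S1 <- nstrips D1, S2 <- nstrips D2]).
Proof.
move=> D12.
have sub1 S : S \in nstrips D1 -> S `<=` D1.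
  by rewrite mem_nstrips => /andP[/strip_sub].
have sub2 S : S \in nstrips D2 -> S `<=` D2.
  by rewrite mem_nstrips => /andP[/strip_sub].
have n1 S : S \in nstrips D1 -> S != fset0 by rewrite mem_nstrips => /andP[].
have n2 S : S \in nstrips D2 -> S != fset0 by rewrite mem_nstrips => /andP[].
(* The intersections with [D1] and [D2] tell the three blocks apart and recover the pair in the last
   one. *)
have I1 S : S \in nstrips D1 -> (S `&` D2 = fset0) * (S `&` D1 = S).
  move=> /sub1 s1; rewrite -{1 2}[S]fsetU0.
  by rewrite (fsetU_splitr D12) ?(fsetU_splitl D12) ?fsub0set.
have I2 S : S \in nstrips D2 -> (S `&` D1 = fset0) * (S `&` D2 = S).
  move=> /sub2 s2; rewrite -{1 2}[S]fset0U.
  by rewrite (fsetU_splitr D12) ?(fsetU_splitl D12) ?fsub0set.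
have I3 S1 S2 : S1 \in nstrips D1 -> S2 \in nstrips D2 ->
    ((S1 `|` S2) `&` D1 = S1) * ((S1 `|` S2) `&` D2 = S2).
  by move=> /sub1 s1 /sub2 s2; rewrite (fsetU_splitr D12) ?(fsetU_splitl D12).
apply: uniq_perm; first exact: uniq_nstrips.
- rewrite !cat_uniq !uniq_nstrips /=; apply/and3P; split.
  + apply/hasPn => S; rewrite mem_cat => /orP[S2|/allpairsP[[S1 S2] /= [h1 h2 ->]]].
      by apply/negP => S1; have := n1 _ S1; rewrite -(I1 _ S1) (I2 _ S2) eqxx.
    apply/negP => h; have := n2 _ h2; rewrite -[S2](I3 _ _ h1 h2).
    by rewrite (I1 _ h) eqxx.
  + apply/hasPn => S /allpairsP[[S1 S2] /= [h1 h2 ->]].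
    apply/negP => h; have := n1 _ h1; rewrite -[S1](I3 _ _ h1 h2).
    by rewrite (I2 _ h) eqxx.
  + apply: allpairs_uniq; rewrite ?uniq_nstrips // => -[S1 S2] [S3 S4].
    move=> /allpairsP[[u v] /= [h1 h2 [-> ->]]].
    move=> /allpairsP[[u' v'] /= [h1' h2' [-> ->]]] E.
    have := I3 _ _ h1 h2; rewrite E; have [-> ->] := I3 _ _ h1' h2'.
    by move=> [-> ->].
move=> S; rewrite !mem_cat; apply/idP/idP; last first.
  case/or3P => [h|h|/allpairsP[[S1 S2] /= [h1 h2 ->]]]; rewrite mem_nstrips.
  - rewrite n1 // andbT -[S]fsetU0; apply: stripU_intro => //; last exact: strip0.
    by move: h; rewrite mem_nstrips => /andP[].
  - rewrite n2 // andbT -[S]fset0U; apply: stripU_intro => //; first exact: strip0.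
    by move: h; rewrite mem_nstrips => /andP[].
  - move: (n1 _ h1); rewrite fsetU_eq0 => /negPf -> /=; rewrite andbT.
    move: h1 h2; rewrite !mem_nstrips => /andP[h1 _] /andP[h2 _].
    exact: stripU_intro.
rewrite mem_nstrips => /andP[hS]; have := fsubsetU_split (strip_sub hS).
set S1 := S `&` D1; set S2 := S `&` D2 => SE S0.
have hS1 : strip D1 S1 by apply: (@stripU_l _ _ D12 S1 S2); rewrite ?fsubsetIr -?SE.
have hS2 : strip D2 S2 by apply: (stripU_r D12 (S1 := S1)); rewrite ?fsubsetIr -?SE.
have [S10|S1n] := eqVneq S1 fset0.
  move: SE; rewrite S10 fset0U => SE; rewrite {2}SE [X in _ || (X || _)]mem_nstrips.
  by rewrite hS2 -SE S0 orbT.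
have [S20|S2n] := eqVneq S2 fset0.
  move: SE; rewrite S20 fsetU0 => SE; rewrite {1}SE mem_nstrips.
  by rewrite hS1 -SE S0.
apply/or3P; apply: Or33; rewrite SE; apply/allpairsP; exists (S1, S2) => /=.
by rewrite !mem_nstrips hS1 hS2 S1n S2n.
Qed.

Lemma perm_nstrips_imfset (g : T -> T) D : injective g ->
    (forall b b', wk (g b) (g b') = wk b b') ->
    (forall b b', st (g b) (g b') = st b b') ->
  perm_eq (nstrips (g @` D)) [seq g @` Y | Y : {fset T} <- nstrips D].
Proof.
move=> gI wkg stg.
have memg (S : {fset T}) b : (g b \in g @` S) = (b \in S) by rewrite mem_imfset.
apply: uniq_perm; first exact: uniq_nstrips.
  rewrite map_inj_uniq ?uniq_nstrips // => S S' E; apply/fsetP => b.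
  by rewrite -(memg S) E memg.
have stripg S : strip (g @` D) (g @` S) = strip D S.
  apply/stripP/stripP => -[/fsubsetP s h]; split.
  - by apply/fsubsetP => b; have := s (g b); rewrite !memg.
  - move=> b b' bS b'D; have := h (g b) (g b'); rewrite !memg // wkg stg.
    exact.
  - by apply/fsubsetP => _ /imfsetP[b /= /s bD ->]; rewrite memg.
  - move=> _ _ /imfsetP[b /= bS ->] /imfsetP[b' /= b'D ->].
    by rewrite memg // wkg stg; apply: h.
have img0 S : (g @` S == fset0) = (S == fset0).
  apply/eqP/eqP => [E|->]; last exact: imfset0.
  by apply/fsetP => b; rewrite -(memg S) E !inE.
move=> S; apply/idP/mapP => [|[S' + ->]]; last by rewrite !mem_nstrips stripg img0.
rewrite mem_nstrips => /andP[hS S0].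
have SE : S = g @` [fset b in D | g b \in S].
  apply/fsetP => b; apply/idP/imfsetP => [bS|[b' /= + ->]]; last by rewrite !inE => /andP[].
  have /fsubsetP/(_ _ bS)/imfsetP[b' /= b'D E] := strip_sub hS.
  by exists b'; rewrite // !inE b'D -E.
by exists [fset b in D | g b \in S]; rewrite // mem_nstrips -stripg -img0 -SE hS.
Qed.

End Strips.

(** * Linearization by successive removal of strips *)

Section StripLinearization.
Context (k : comNzRingType) (U V : lmodType k) (T : choiceType) (wk st : rel T).
Context (cns : U -> V -> V) (one : V) (dm : U -> U -> U).
Hypotheses (dmC : commutative dm) (dmA : associative dm).
Implicit Types (D S : {fset T}) (lab : T -> U).
Local Open Scope fset_scope.
Local Notation strip := (strip wk st).
Local Notation nstrips := (nstrips wk st).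
Local Notation unrelated := (unrelated wk st).

(* The value on the empty set is junk. *)
Definition dm_prod lab S : U :=
  odflt 0 (\big[oAC dmA dmC/None]_(t <- S) Some (lab t)).

(** The product [dm] need not have a unit, so [None] is adjoined as one; it is the result only for
    the empty product. *)
Lemma big_oAC_Some (I : Type) (r : seq I) (F : I -> U) :
  r <> [::] -> \big[oAC dmA dmC/None]_(i <- r) Some (F i) =
    Some (odflt 0 (\big[oAC dmA dmC/None]_(i <- r) Some (F i))).
Proof. by case: r => // i r _; rewrite big_cons; case: (\big[_/_]_(i <- r) _). Qed.

Lemma fset_neq_nil S : S != fset0 -> enum_fset S <> [::].
Proof.
move=> S0 E; case/eqP: S0.
by apply/fsetP => b; rewrite inE -[_ \in S]/(_ \in enum_fset S) E.
Qed.

Lemma dm_prodE lab S : S != fset0 ->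
  \big[oAC dmA dmC/None]_(t <- S) Some (lab t) = Some (dm_prod lab S).
Proof. by move=> /fset_neq_nil; apply: big_oAC_Some. Qed.

Lemma dm_prodU lab S1 S2 : S1 != fset0 -> S2 != fset0 -> [disjoint S1 & S2] ->
  dm_prod lab (S1 `|` S2) = dm (dm_prod lab S1) (dm_prod lab S2).
Proof.
move=> n1 n2 d12; rewrite {1}/dm_prod.
have p12 : perm_eq (S1 `|` S2) (S1 ++ S2).
  apply: uniq_perm => [||b]; [exact: fset_uniq| |by rewrite mem_cat inE].
  rewrite cat_uniq !fset_uniq andbT /=; apply/hasPn => b b2; apply/negP => b1.
  by have /fdisjointP/(_ b b1) := d12; rewrite b2.
by rewrite (perm_big _ p12) big_cat !dm_prodE.
Qed.

(** The bound [n] makes the recursion structural. Removing a non-empty strip shrinks [D], so the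
    cardinality of [D] is a sufficient bound. *)
Fixpoint strip_lin_rec lab n D : V :=
  if D == fset0 then one else
  if n is n'.+1 then
    \sum_(S <- nstrips D) cns (dm_prod lab S) (strip_lin_rec lab n' (D `\` S))
  else 0.

Definition strip_lin lab D := strip_lin_rec lab #|` D| D.

Lemma nstrips_sub D S : S \in nstrips D -> S `<=` D.
Proof. by rewrite mem_nstrips => /andP[/strip_sub]. Qed.

Lemma card_nstrip D S : S \in nstrips D -> (#|` D `\` S| < #|` D|)%N.
Proof.
move=> hS; have := cardfsDS (nstrips_sub hS).
have := fsubset_leq_card (nstrips_sub hS).
by move: hS; rewrite mem_nstrips -cardfs_gt0 => /andP[_]; lia.
Qed.

Lemma strip_lin_rec_stable lab n D :
  (#|` D| <= n)%N -> strip_lin_rec lab n D = strip_lin lab D.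
Proof.
have rec0 j : strip_lin_rec lab j fset0 = one by case: j.
rewrite /strip_lin; have [m] := ubnP #|` D|.
elim: m n D => // m IHm n D Dm Dn.
have [->|D0] := eqVneq D fset0; first by rewrite !rec0.
have := D0; rewrite -cardfs_gt0 => Dgt0.
case: n Dn => [|n] Dn; first by rewrite leqNgt Dgt0 in Dn.
case E: #|` D| Dgt0 => [//|c] _ /=; rewrite (negPf D0); apply: eq_big_seq => S hS.
have := card_nstrip hS; rewrite E => lt.
by rewrite !IHm //; lia.
Qed.

Lemma strip_lin0 lab : strip_lin lab fset0 = one.
Proof. by rewrite /strip_lin cardfs0. Qed.

Lemma strip_linE lab D : D != fset0 ->
  strip_lin lab D = \sum_(S <- nstrips D) cns (dm_prod lab S) (strip_lin lab (D `\` S)).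
Proof.
move=> D0; have := D0; rewrite -cardfs_gt0 {1}/strip_lin.
case E: #|` D| => [//|c] _ /=; rewrite (negPf D0); apply: eq_big_seq => S hS.
by rewrite strip_lin_rec_stable // -ltnS -E card_nstrip.
Qed.

(** Only the two relations and the labels enter the recursion, and [g] transports them all. This
    serves for translations of diagrams. *)
Lemma strip_lin_imfset (g : T -> T) lab lab' D : injective g ->
    (forall b b', wk (g b) (g b') = wk b b') ->
    (forall b b', st (g b) (g b') = st b b') ->
    {in D, forall b, lab' (g b) = lab b} ->
  strip_lin lab' (g @` D) = strip_lin lab D.
Proof.
move=> gI wkg stg; have [n] := ubnP #|` D|; elim: n D => // n IHn D ltn labg.
have memg S b : (g b \in g @` S) = (b \in S) by rewrite mem_imfset.
have [->|D0] := eqVneq D fset0; first by rewrite imfset0 !strip_lin0.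
rewrite !strip_linE //; last first.
  have /fset0Pn[b bD] := D0; by apply/fset0Pn; exists (g b); rewrite memg.
rewrite (perm_big _ (perm_nstrips_imfset D gI wkg stg)) big_map.
apply: eq_big_seq => S hS; have /fsubsetP sSD := nstrips_sub hS.
congr cns.
  rewrite /dm_prod (perm_big _ (enum_imfset imfset_key (in2W gI))) big_map.
  by congr odflt; apply: eq_big_seq => b bS; rewrite labg // sSD.
have -> : g @` D `\` g @` S = g @` (D `\` S).
  apply/fsetP => b; apply/idP/imfsetP => [|[b' /= + ->]]; last by rewrite !inE !memg.
  rewrite !inE => /andP[+ /imfsetP[b' /= b'D E]]; rewrite E memg => b'S.
  by exists b'; rewrite // !inE b'S.
apply: IHn; first by apply: leq_trans (card_nstrip hS) _.
by move=> b; rewrite inE => /andP[_ /labg].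
Qed.

Section Product.
Variable q : V -> V -> V.
Hypotheses (q_l : forall y, plinear (q^~ y)) (q_r : forall x, plinear (q x)).
Hypotheses (q1l : forall x, q one x = x) (q1r : forall x, q x one = x).
Hypothesis q_cons : forall x y p r,
  q (cns x p) (cns y r) =
    (cns x (q p (cns y r)) + cns y (q (cns x p) r) + cns (dm x y) (q p r))%R.
Hypothesis cns_r : forall x, plinear (cns x).

(** Induction on the total number of boxes: the three terms of [q_cons], summed over pairs of first
    strips, are the three blocks of [perm_nstripsU]. *)
Lemma strip_linU lab D1 D2 : unrelated D1 D2 ->
  strip_lin lab (D1 `|` D2) = q (strip_lin lab D1) (strip_lin lab D2).
Proof.
have [n] := ubnP (#|` D1| + #|` D2|)%N; elim: n D1 D2 => // n IHn D1 D2 ltn D12.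
have [E|D1n] := eqVneq D1 fset0; first by rewrite E fset0U strip_lin0 q1l.
have [E|D2n] := eqVneq D2 fset0; first by rewrite E fsetU0 strip_lin0 q1r.
have dis b : b \in D1 -> b \in D2 -> false by exact: (unrelated_disjoint D12).
rewrite strip_linE ?fsetU_eq0 ?negb_and ?D1n //.
rewrite (perm_big _ (perm_nstripsU D12)) /= !big_cat big_allpairs_dep /=.
have diffl S : S \in nstrips D1 -> (D1 `|` D2) `\` S = (D1 `\` S) `|` D2.
  move=> /nstrips_sub/fsubsetP sS; apply/fsetP => b; rewrite !inE.
  by have [/sS b1|//] := boolP (b \in S); apply/esym/negP => /(dis _ b1).
have diffr S : S \in nstrips D2 -> (D1 `|` D2) `\` S = D1 `|` (D2 `\` S).
  move=> /nstrips_sub/fsubsetP sS; apply/fsetP => b; rewrite !inE.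
  have [/sS b2|//] := boolP (b \in S); rewrite orbF.
  by apply/esym/negP => b1; have := dis _ b1 b2.
have difflr S S' : S \in nstrips D1 -> S' \in nstrips D2 ->
    (D1 `|` D2) `\` (S `|` S') = (D1 `\` S) `|` (D2 `\` S').
  move=> /nstrips_sub/fsubsetP sS /nstrips_sub/fsubsetP sS'.
  apply/fsetP => b; rewrite !inE; have [b1|b1] := boolP (b \in D1).
    have b2 : b \notin D2 by apply/negP => /(dis _ b1).
    by rewrite (contraNF (sS' b) b2) (negPf b2) orbF !andbF !andbT orbF.
  by rewrite (contraNF (sS b) b1) !andbF.
have IH S1 S2 : S1 `<=` D1 -> S2 `<=` D2 ->
    (#|` S1| + #|` S2| < #|` D1| + #|` D2|)%N ->
    strip_lin lab (S1 `|` S2) = q (strip_lin lab S1) (strip_lin lab S2).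
  move=> s1 s2 lt; apply: IHn; first by apply: leq_trans lt _.
  exact: unrelatedS s1 s2 D12.
pose c1 S := cns (dm_prod lab S) (strip_lin lab (D1 `\` S)).
pose c2 S := cns (dm_prod lab S) (strip_lin lab (D2 `\` S)).
have E1 : strip_lin lab D1 = \sum_(S <- nstrips D1) c1 S by apply: strip_linE.
have E2 : strip_lin lab D2 = \sum_(S <- nstrips D2) c2 S by apply: strip_linE.
transitivity
  (\sum_(S1 <- nstrips D1) \sum_(S2 <- nstrips D2)
     ((cns (dm_prod lab S1) (q (strip_lin lab (D1 `\` S1)) (c2 S2))
      + cns (dm_prod lab S2) (q (c1 S1) (strip_lin lab (D2 `\` S2)))
      + cns (dm (dm_prod lab S1) (dm_prod lab S2))
          (q (strip_lin lab (D1 `\` S1)) (strip_lin lab (D2 `\` S2))))%R));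
  last first.
  rewrite E1 (plinear_sum _ _ _ (q_l _)); apply: eq_bigr => S1 _.
  rewrite E2 (plinear_sum _ _ _ (q_r _)); apply: eq_bigr => S2 _.
  by rewrite q_cons.
under [RHS]eq_bigr do rewrite 2!big_split /=.
rewrite 2!big_split /= -addrA; congr (_ + (_ + _))%R.
(* Only a strip of [D1] is removed here; the sum over [S2] reassembles the linearization of the
   whole of [D2]. The next case is symmetric. *)
- apply: eq_big_seq => S1 h1.
  rewrite -(plinear_sum _ _ _ (cns_r _)) -(plinear_sum _ _ _ (q_r _)) -E2.
  by rewrite diffl // IH ?fsubsetDl // ltn_add2r card_nstrip.
- rewrite exchange_big; apply: eq_big_seq => S2 h2.
  rewrite -(plinear_sum _ _ _ (cns_r _)) -(plinear_sum _ _ _ (q_l _)) -E1.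
  by rewrite diffr // IH ?fsubsetDl // ltn_add2l card_nstrip.
- apply: eq_big_seq => S1 h1; apply: eq_big_seq => S2 h2.
  rewrite difflr // IH ?fsubsetDl //; last first.
    by have := card_nstrip h1; have := card_nstrip h2; lia.
  rewrite dm_prodU //; last 1 first.
  + apply/fdisjointP => b /(fsubsetP (nstrips_sub h1)) b1; apply/negP.
    by move=> /(fsubsetP (nstrips_sub h2)) /(dis _ b1).
  + by move: h1; rewrite mem_nstrips => /andP[].
  + by move: h2; rewrite mem_nstrips => /andP[].
Qed.

End Product.
End StripLinearization.

(** * Evaluation and semistandard fillings *)

Section AbstractEvaluation.
Context (k : comNzRingType) (U V : lmodType k) (A : Type).
Context (W : seq A -> V) (e : A -> U) (cns : U -> V -> V).
Context (dm : U -> U -> U) (q : V -> V -> V).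
Local Notation one := (W [::]).
Context (P : comAlgType k) (X : eqType) (f : X -> U -> P) (ev : seq X -> V -> P).
Hypotheses (spanV : spans W).
Hypotheses (q_l : forall y, plinear (q^~ y)) (q_r : forall x, plinear (q x)).
Hypotheses (q1W : forall v, q one (W v) = W v) (qW1 : forall u, q (W u) one = W u).
Hypothesis W_cons : forall a u, W (a :: u) = cns (e a) (W u).
Hypothesis q_consW : forall a u b v, q (W (a :: u)) (W (b :: v)) =
  cns (e a) (q (W u) (W (b :: v))) + cns (e b) (q (W (a :: u)) (W v))
  + cns (dm (e a) (e b)) (q (W u) (W v)).
Hypotheses (ev_lin : forall s, plinear (ev s)) (ev1 : forall s, ev s one = 1).
Hypothesis ev_nil_cons : forall x p, ev [::] (cns x p) = 0.
Hypothesis ev_cons : forall m s x p,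
  ev (m :: s) (cns x p) = f m x * ev s p + ev s (cns x p).
Hypothesis fM : forall m x y, f m (dm x y) = f m x * f m y.

Lemma plinear_mulr (p : P) : plinear ( *%R p).
Proof. by move=> c x y; rewrite mulrDr scalerAr. Qed.

Lemma plinear_mull (p : P) : plinear ( *%R^~ p).
Proof. by move=> c x y; rewrite mulrDl scalerAl. Qed.

(** Induction on the letters. The letter [m] is used by the first word only, by the second only, by
    both, or by neither; the third case is the merged term, by [fM], and the last is the induction
    hypothesis. *)
Lemma abs_evalM s x y : ev s (q x y) = ev s x * ev s y.
Proof.
have ED s' p r : ev s' (p + r) = ev s' p + ev s' r by exact: (plinearD p r (ev_lin s')).
move: x; apply: (@plinear_ext k V P _ W _ _ spanV) => [||u].
- exact: plinear_comp (ev_lin _) (q_l _).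
- exact: plinear_comp (plinear_mull _) (ev_lin _).
move: y; apply: (@plinear_ext k V P _ W _ _ spanV) => [||v].
- exact: plinear_comp (ev_lin _) (q_r _).
- exact: plinear_comp (plinear_mulr _) (ev_lin _).
elim: s u v => [|m s IHs] [|a u] v.
- by rewrite q1W ev1 mul1r.
- case: v => [|b v]; first by rewrite qW1 ev1 mulr1.
  by rewrite q_consW !ED !ev_nil_cons W_cons ev_nil_cons mul0r !addr0.
- by rewrite q1W ev1 mul1r.
case: v => [|b v]; first by rewrite qW1 ev1 mulr1.
have := IHs (a :: u) (b :: v).
rewrite q_consW !ED !ev_cons fM !IHs !W_cons !ev_cons -!W_cons.
set c1 := ev s (cns (e a) (q _ _)); set c2 := ev s (cns (e b) (q _ _)).
set c3 := ev s (cns (dm _ _) _) => E3.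
rewrite mulrDl !mulrDr -E3 [f m (e a) * _ * (f m (e b) * _)]mulrACA.
rewrite [ev s (W (a :: u)) * (f m _ * _)]mulrCA !mulrA !addrA.
by rewrite [LHS](ACl (5*1*3*2*4*6)%AC).
Qed.

End AbstractEvaluation.

(** * Evaluation of the linearization as a sum over fillings *)

Section AbstractSchur.
Context (k : comNzRingType) (U V : lmodType k) (T : choiceType) (wk st : rel T).
Context (cns : U -> V -> V) (one : V) (dm : U -> U -> U).
Hypotheses (dmC : commutative dm) (dmA : associative dm).
Context (d : Order.disp_t) (X : finOrderType d) (E : {fset T}) (lab : T -> U).
Context (P : comAlgType k) (f : X -> U -> P) (ev : seq X -> V -> P).
Hypotheses (ev_lin : forall s, plinear (ev s)) (ev1 : forall s, ev s one = 1).
Hypothesis ev_nil_cons : forall x p, ev [::] (cns x p) = 0.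
Hypothesis ev_cons : forall m s x p,
  ev (m :: s) (cns x p) = f m x * ev s p + ev s (cns x p).
Hypothesis fM : forall m x y, f m (dm x y) = f m x * f m y.
Local Open Scope fset_scope.
Implicit Types (D S : {fset T}).
Local Notation strip := (strip wk st).
Local Notation nstrips := (nstrips wk st).
Local Notation strip_lin := (strip_lin wk st cns one dmC dmA lab).

Lemma f_dm_prod m S : S != fset0 ->
  f m (dm_prod dmC dmA lab S) = (\prod_(t <- S) f m (lab t))%R.
Proof.
move=> /fset_neq_nil; rewrite /dm_prod.
elim: (enum_fset S) => // t r IHr _; rewrite !big_cons.
have [->|/eqP r0] := eqVneq r [::]; first by rewrite !big_nil mulr1.
by rewrite big_oAC_Some //= fM IHr.
Qed.

Lemma ev_strip_lin_nil D : D != fset0 -> ev [::] (strip_lin D) = 0.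
Proof.
move=> D0; rewrite strip_linE // (plinear_sum _ _ _ (ev_lin _)).
by rewrite big1 // => S _; rewrite ev_nil_cons.
Qed.

(** The strip [S] consists of the boxes receiving the letter [x]. The empty strip, absent from the
    linearization, accounts for the evaluations in which [x] is skipped. *)
Lemma ev_strip_lin_cons x s D :
  ev (x :: s) (strip_lin D) =
    (\sum_(S <- strips wk st D)
       (\prod_(t <- S) f x (lab t)) * ev s (strip_lin (D `\` S)))%R.
Proof.
rewrite (perm_big _ (perm_strips wk st D)) big_cons /= big_seq_fset0 mul1r fsetD0.
have [->|D0] := eqVneq D fset0.
  rewrite strip_lin0 !ev1 big1_seq ?addr0 // => S /=.
  by rewrite mem_nstrips => /andP[/strip_sub]; rewrite fsubset0 => ->.
rewrite {1 2}strip_linE // !(plinear_sum _ _ _ (ev_lin _)).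
rewrite [RHS]addrC -big_split; apply: eq_big_seq => S hS; rewrite ev_cons f_dm_prod //.
by move: hS; rewrite mem_nstrips => /andP[].
Qed.

(* Prescribing the values outside [D] by [m0] makes all the fillings share the index
   type [{ffun E -> X}], so that the recursion on [D] needs no reindexing. *)
Definition filling (s : seq X) D (m0 m : {ffun E -> X}) :=
  [forall t : E, if val t \in D then m t \in s else m t == m0 t] &&
  [forall t : E, forall t' : E, (val t \in D) && (val t' \in D) ==>
    (wk (val t') (val t) ==> (m t' <= m t)%O) &&
    (st (val t') (val t) ==> (m t' < m t)%O)].

Lemma fillingP (s : seq X) D (m0 m : {ffun E -> X}) : reflect
  ((forall t : E, if val t \in D then m t \in s else m t == m0 t) /\
   (forall t t' : E, val t \in D -> val t' \in D ->
      (wk (val t') (val t) -> (m t' <= m t)%O) /\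
      (st (val t') (val t) -> (m t' < m t)%O)))
  (filling s D m0 m).
Proof.
apply: (iffP andP) => [[/forallP h1 /forallP h2]|[h1 h2]]; split=> //.
- move=> t t' tD t'D; have := forallP (h2 t) t'; rewrite tD t'D /=.
  by case/andP => /implyP ? /implyP.
- exact/forallP.
- apply/forallP => t; apply/forallP => t'; apply/implyP => /andP[tD t'D].
  by have [h h'] := h2 _ _ tD t'D; apply/andP; split; apply/implyP.
Qed.

Definition level x D (m : {ffun E -> X}) : {fset T} :=
  [fset val t | t in {: E} & (val t \in D) && (m t == x)].

Lemma mem_level x D (m : {ffun E -> X}) (t : E) :
  (val t \in level x D m) = (val t \in D) && (m t == x).
Proof.
rewrite mem_imfset /=; last exact: val_inj.
by rewrite !inE.
Qed.

Lemma level_sub x D (m : {ffun E -> X}) : level x D m `<=` D.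
Proof. by apply/fsubsetP => _ /imfsetP[t /= + ->]; rewrite !inE => /andP[]. Qed.

(** Since [x] is the least letter, a box whose entry must be weakly below an [x] also contains [x],
    and no entry can be strictly below it. *)
Lemma level_strip x (s : seq X) D (m0 m : {ffun E -> X}) :
  (forall y, y \in s -> (x < y)%O) -> D `<=` E ->
  filling (x :: s) D m0 m -> strip D (level x D m).
Proof.
move=> xs /fsubsetP DE /fillingP[h1 h2]; apply/stripP; split=> [|b b' + b'D].
  exact: level_sub.
move=> /imfsetP[t /= + ->]; rewrite !inE => /andP[tD /eqP tx].
pose t' : E := [` DE _ b'D].
have [hw hs] := h2 t t' tD b'D.
have := h1 t'; rewrite /= b'D inE => xt'.
have {xt'} xt' : (x <= m t')%O by case/predU1P: xt' => [->//|/xs/ltW].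
split; last by apply/negP => /hs; rewrite tx ltNge xt'.
move=> /hw; rewrite tx => t'x.
by rewrite -[b']/(val t') mem_level b'D eq_le t'x.
Qed.

(** Once the boxes of the least letter are fixed, they leave [D] and their value passes to the
    prescribed function. The order conditions between [S] and the rest follow from [S] being a strip
    and [x] being least. *)
Lemma filling_cons x (s : seq X) D S (m0 m : {ffun E -> X}) :
  (forall y, y \in s -> (x < y)%O) -> D `<=` E -> strip D S ->
  filling (x :: s) D m0 m && (S == level x D m) =
  filling s (D `\` S) [ffun t => if val t \in S then x else m0 t] m.
Proof.
move=> xs /fsubsetP DE hS; have /fsubsetP SD := strip_sub hS.
have xNs : x \notin s by apply/negP => /xs; rewrite ltxx.
apply/andP/fillingP => [[/fillingP[h1 h2] /eqP SE]|[h1 h2]].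
  split=> [t|t t'].
    have := h1 t; rewrite ffunE inE; have [tS|tS] := boolP (val t \in S).
      by move: tS; rewrite {1}SE mem_level => /andP[_ ->].
    rewrite /=; case: ifP => // tD; rewrite inE => /predU1P[tx|//].
    by move: tS; rewrite SE mem_level tD tx eqxx.
  by rewrite !inE => /andP[_ tD] /andP[_ t'D]; apply: h2.
have mS (t : E) : val t \in S -> m t = x.
  by move=> tS; have := h1 t; rewrite ffunE inE tS => /eqP.
have mDS (t : E) : val t \in D -> val t \notin S -> m t \in s.
  by move=> tD tS; have := h1 t; rewrite inE tD tS.
split.
  apply/fillingP; split=> [t|t t' tD t'D].
    have := h1 t; rewrite ffunE inE; have [tS|tS] := boolP (val t \in S).
      by rewrite /= SD // inE => /eqP ->; rewrite eqxx.
    by rewrite /=; case: ifP => // _; rewrite inE => ->; rewrite orbT.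
  have /stripP[_ hst] := hS.
  have [tS|tS] := boolP (val t \in S).
    have [hw hs] := hst _ _ tS t'D; split; last by rewrite (negPf hs).
    by move=> /hw t'S; rewrite !mS.
  have xt := xs _ (mDS _ tD tS).
  have [t'S|t'S] := boolP (val t' \in S); first by rewrite (mS _ t'S) xt ltW.
  by apply: h2; rewrite inE ?tS ?t'S.
apply/eqP/fsetP => b; apply/idP/idP => [bS|/imfsetP[t /= + ->]].
  have bE := DE _ (SD _ bS); rewrite -[b]/(val [` bE]) mem_level /= SD //=.
  by rewrite mS.
rewrite !inE => /andP[tD /eqP tx].
by apply/negPn/negP => tS; have := mDS _ tD tS; rewrite tx (negPf xNs).
Qed.

(** Induction on the letters, the fillings being grouped by the set of boxes that contain the least
    one. *)
Lemma ev_strip_lin (s : seq X) D (m0 : {ffun E -> X}) :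
  sorted <%O s -> D `<=` E ->
  ev s (strip_lin D) =
    (\sum_(m | filling s D m0 m) \prod_(t : E | val t \in D) f (m t) (lab (val t)))%R.
Proof.
elim: s D m0 => [|x s IHs] D m0 ss DE.
  have [D0|D0] := eqVneq D fset0.
    rewrite D0 strip_lin0 ev1 (big_pred1 m0) => [|m].
      by rewrite big_pred0 // => t; rewrite inE.
    apply/fillingP/eqP => [[h _]|->]; last by split=> [t|t t']; rewrite !inE.
    by apply/ffunP => t; have := h t; rewrite inE => /eqP.
  rewrite ev_strip_lin_nil // big_pred0 // => m; apply/negP => /fillingP[h _].
  have /fset0Pn[b bD] := D0; have bE := fsubsetP DE _ bD.
  by have := h [` bE]; rewrite /= bD.
have xs y : y \in s -> (x < y)%O.
  by move: ss; rewrite /= path_sortedE => [/andP[/allP h _] /h//|]; exact: lt_trans.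
rewrite ev_strip_lin_cons.
(* Every filling is counted for exactly one strip, its level set for [x]. *)
transitivity (\sum_(S <- strips wk st D)
   \sum_(m | filling (x :: s) D m0 m && (S == level x D m))
   \prod_(t : E | val t \in D) f (m t) (lab (val t)))%R; last first.
  rewrite [LHS](exchange_big_dep (filling (x :: s) D m0)) /=; last first.
    by move=> S m _ /andP[].
  apply: eq_bigr => m hm; rewrite hm /=.
  rewrite [LHS](big_rem (level x D m)) ?mem_strips ?(level_strip xs DE hm) //=.
  rewrite eqxx [X in (_ + X)%R]big1_seq ?addr0 // => S /andP[/eqP ->].
  by rewrite mem_rem_uniqF ?uniq_strips.
apply: eq_big_seq => S; rewrite mem_strips => hS.
under [RHS]eq_bigl do rewrite filling_cons //.
rewrite (IHs _ [ffun t => if val t \in S then x else m0 t]); first last.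
- by apply: fsubset_trans DE; apply: fsubsetDl.
- by move: ss => /= /path_sorted.
rewrite mulr_sumr; apply: eq_bigr => m /fillingP[h1 _].
(* The boxes of [S] contribute the factors [f x]; the other boxes form the product of the induction
   hypothesis. *)
rewrite [RHS](bigID (fun t : E => val t \in S)) /=; congr (_ * _)%R.
  have SD := fsubsetP (strip_sub hS).
  transitivity (\prod_(t : E | val t \in S) f x (lab (val t)))%R.
    rewrite -(big_seq_fsetE _ E (fun b => b \in S) (fun b => f x (lab b)))
      -[RHS]big_filter.
    apply: perm_big; apply: uniq_perm; rewrite ?filter_uniq ?fset_uniq // => b.
    rewrite mem_filter; have [bS|//] := boolP (b \in S).
    by rewrite (fsubsetP DE) ?SD.
  apply: eq_big => [t|t tS].
    by have [/SD ->|_] := boolP (val t \in S); rewrite ?andbF.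
  by have := h1 t; rewrite ffunE inE tS => /eqP ->.
by apply: eq_bigl => t; rewrite inE andbC.
Qed.

End AbstractSchur.

(** * Chains of partitions and tableaux *)

Section Chains.
Context (k : comNzRingType) (U V : lmodType k) (T : choiceType) (wk st : rel T).
Context (cns : U -> V -> V) (one : V) (dm : U -> U -> U).
Hypotheses (dmC : commutative dm) (dmA : associative dm).
Context (lab : T -> U).
Hypothesis cns_r : forall x, plinear (cns x).
Implicit Types (D S : {fset T}) (Ds : seq {fset T}).
Local Open Scope fset_scope.
Local Notation nstrips := (nstrips wk st).

Fixpoint strip_chain D Ds : bool :=
  if Ds is Y :: Ds' then (Y \in nstrips D) && strip_chain (D `\` Y) Ds'
  else D == fset0.

(** A finite enumeration of the sequences accepted by [strip_chain], which turns the sum over the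
    set [SSD] into a sum over a list. *)
Fixpoint chains n D : seq (seq {fset T}) :=
  if D == fset0 then [:: [::]] else
  if n is n'.+1 then
    [seq Y :: Ds | Y : {fset T} <- nstrips D, Ds : seq {fset T} <- chains n' (D `\` Y)]
  else [::].

Lemma nstrips0 : nstrips fset0 = [::].
Proof.
case E: (nstrips fset0) => [//|S r]; have : S \in nstrips fset0 by rewrite E mem_head.
by rewrite mem_nstrips => /andP[/strip_sub]; rewrite fsubset0 => ->.
Qed.

Lemma mem_chains n D Ds : (#|` D| <= n)%N -> (Ds \in chains n D) = strip_chain D Ds.
Proof.
elim: n D Ds => [|n IHn] D Ds Dn.
  move: Dn; rewrite leqn0 cardfs_eq0 => /eqP -> /=; rewrite inE.
  by case: Ds => [|S Ds] /=; rewrite ?nstrips0 // ?eqxx.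
have [->|D0] := eqVneq D fset0.
  by rewrite /= inE; case: Ds => [|S Ds] /=; rewrite ?nstrips0 // ?eqxx.
rewrite /= (negPf D0); apply/allpairsPdep/idP => [[S [Ds' [hS + ->]]]|].
  by rewrite IHn /= ?hS //; have := card_nstrip hS; lia.
case: Ds => [|S Ds] /=; first by rewrite (negPf D0).
move=> /andP[hS h]; exists S, Ds; split=> //; rewrite IHn //.
by have := card_nstrip hS; lia.
Qed.

Lemma uniq_chains n D : uniq (chains n D).
Proof.
elim: n D => [|n IHn] D /=; case: ifP => // _.
apply: allpairs_uniq_dep => //; first exact: uniq_nstrips.
by move=> [S Ds] [S' Ds'] /= _ _ [-> ->].
Qed.

Lemma strip_lin_chains D :
  strip_lin wk st cns one dmC dmA lab D =
    (\sum_(Ds <- chains #|` D| D) foldr (fun S => cns (dm_prod dmC dmA lab S)) one Ds)%R.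
Proof.
rewrite /strip_lin; move: #|` D| => n; elim: n D => [|n IHn] D /=; case: ifP => D0.
- by rewrite big_seq1.
- by rewrite big_nil.
- by rewrite big_seq1.
rewrite big_allpairs_dep; apply: eq_bigr => S _ /=.
by rewrite IHn (plinear_sum _ _ _ (cns_r _)).
Qed.
End Chains.

(** * Horizontal strips of skew diagrams and chains of partitions *)

Section Partitions.
Local Open Scope nat_scope.
Implicit Types la mu eta : intpart.

(** Zero parts are excluded, so the entries padded by zeros determine the length as well. *)
Lemma eq_intpart la mu : (forall i, nth 0 la i = nth 0 mu i) -> la = mu.
Proof.
move=> E; apply: val_inj.
have sz (l m : intpart) : (forall i, nth 0 l i = nth 0 m i) -> size m <= size l.
  move=> E'; rewrite leqNgt; apply/negP => lt; have /andP[_ /negP[]] := valP m.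
  have := mem_nth 0 lt; rewrite -E' nth_default //; exact: leqnn.
by apply: (@eq_from_nth _ 0) => [|i _]; [apply/eqP; rewrite eqn_leq !sz|].
Qed.

Lemma intpart_of (g : nat -> nat) n :
  (forall i, g i.+1 <= g i) -> (forall i, n <= i -> g i = 0) ->
  exists la : intpart, forall i, nth 0 la i = g i.
Proof.
move=> gd g0.
have gD i j : i <= j -> g j <= g i.
  by move=> /subnK <-; elim: (j - i) => // c; apply: leq_trans (gd _).
have srt : sorted geq (mkseq g n).
  by apply: (@homo_sorted _ _ _ leq geq) (iota_sorted 0 n) => i j /= /gD.
have gt : is_intpart [seq x <- mkseq g n | 0 < x].
  rewrite /is_intpart mem_filter ltnn /= andbT.
  by apply: sorted_filter srt; apply: rev_trans leq_trans.
exists (IntPart gt) => i /=; rewrite nth_filter_gt0 //.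
have [lt|ge] := ltnP i n; first by rewrite nth_mkseq.
by rewrite nth_default ?size_mkseq // g0.
Qed.

Lemma includedP (mu la : seq nat) :
  reflect (forall i, nth 0 mu i <= nth 0 la i) (included mu la).
Proof.
apply: (iffP idP) => [h i|h]; first exact: included_nth.
by apply/allP => i _.
Qed.

Lemma included_trans (mu eta la : seq nat) :
  included mu eta -> included eta la -> included mu la.
Proof.
move=> /includedP h1 /includedP h2; apply/includedP => i.
exact: leq_trans (h1 i) (h2 i).
Qed.

Definition left_of : rel (nat * nat) := fun b b' => b' == (b.1, b.2.+1).
Definition above : rel (nat * nat) := fun b b' => b' == (b.1.+1, b.2).
Local Notation strip := (strip left_of above).
Local Notation nstrips := (nstrips left_of above).
Local Notation strip_chain := (strip_chain left_of above).

Lemma hstripP (la mu : seq nat) : reflect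
  (forall i i' j, (i, j) \in boxes la mu -> (i', j) \in boxes la mu -> i = i')
  (hstrip la mu).
Proof.
apply: (iffP forallP) => [h i i' j ib ib'|h b].
  have /forallP/(_ [` ib']%fset)/implyP/(_ (eqxx _))/eqP := h [` ib]%fset.
  by move=> /(congr1 val) [].
apply/forallP => b'; apply/implyP => /eqP E; apply/eqP/val_inj.
have := valP b; have := valP b'; move: E.
case: (val b) => i j; case: (val b') => i' j' /= ->.
by move=> /h h1 /h1 ->.
Qed.

Lemma boxesD (la mu eta : intpart) : included mu eta -> included eta la ->
  (boxes la mu `\` boxes eta mu = boxes la eta)%fset.
Proof.
move=> /includedP h1 /includedP h2; apply/fsetP => -[i j]; rewrite inE !mem_boxes.
by have := h1 i; have := h2 i; lia.
Qed.

Lemma boxes_eq0 la mu : included mu la -> (boxes la mu == fset0) = (mu == la).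
Proof.
move=> /includedP h; apply/eqP/eqP => [E|->]; last first.
  by apply/fsetP => -[i j]; rewrite mem_boxes inE; lia.
apply: eq_intpart => i; apply/eqP; rewrite eqn_leq h /= leqNgt; apply/negP => lt.
have : (i, nth 0 mu i) \in boxes la mu by rewrite mem_boxes leqnn.
by rewrite E inE.
Qed.

Lemma hstrip_strip (la mu eta : intpart) :
    mu != eta -> included mu eta -> included eta la -> hstrip eta mu ->
  boxes eta mu \in nstrips (boxes la mu).
Proof.
move=> ne me el /hstripP hs; rewrite mem_nstrips boxes_eq0 // ne andbT.
have [h1 h2] := (includedP _ _ me, includedP _ _ el).
apply/stripP; split.
  by apply/fsubsetP => -[i j]; rewrite !mem_boxes; have := h2 i; lia.
move=> [i j] [i' j'] bS b'D; split=> [/eqP[E1 E2]|].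
  by move: bS b'D; rewrite !mem_boxes E1 E2; lia.
apply/negP => /eqP[E1 E2]; rewrite E1 E2 in bS.
(* A box of the diagram above a strip box lies in the partition [eta], hence in the strip, which
   would then have two boxes in one column. *)
have b'S : (i', j') \in boxes eta mu.
  move: bS b'D; rewrite !mem_boxes; have := intpart_nth eta (leqnSn i'); lia.
by have := hs _ _ _ bS b'S; lia.
Qed.

(** Closure under left neighbours makes each row of [S] an initial segment of that row of the
    diagram; the ends of these segments are the parts of [eta]. *)
Lemma strip_hstrip (la mu : intpart) S :
    included mu la -> S \in nstrips (boxes la mu) ->
  exists eta : intpart, [/\ mu != eta, included mu eta, included eta la,
    hstrip eta mu & S = boxes eta mu].
Proof.
move=> ml; rewrite mem_nstrips => /andP[/stripP[/fsubsetP SD hS] S0].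
have h := includedP _ _ ml.
pose r i := iota (nth 0 mu i) (nth 0 la i - nth 0 mu i).
(* The first column at which row [i] leaves [S]. If the whole row is in [S], [find] returns its
   length and [g i] is the outer part. *)
pose g i := nth 0 mu i + find (fun j => (i, j) \notin S) (r i).
have gle i : g i <= nth 0 la i.
  have := find_size (fun j => (i, j) \notin S) (r i).
  by rewrite size_iota /g; have := h i; lia.
have Sin i j : nth 0 mu i <= j < g i -> (i, j) \in S.
  move=> /andP[h1 h2]; have lt : j - nth 0 mu i < find (fun j => (i, j) \notin S) (r i).
    by rewrite /g in h2; lia.
  have := before_find (nth 0 mu i) lt; rewrite nth_iota; last first.
    by have := gle i; rewrite /g; lia.
  by rewrite subnKC // => /negbFE.
have down i j c : nth 0 mu i <= j -> (i, j + c) \in S -> (i, j) \in S.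
  move=> mj; elim: c => [|c IHc]; first by rewrite addn0.
  move=> jc; apply: IHc; have jcD := SD _ jc.
  have jD : (i, j + c) \in boxes la mu by move: jcD; rewrite !mem_boxes; lia.
  by have [hw _] := hS _ _ jc jD; apply: hw; rewrite /left_of /= addnS.
have SE i j : ((i, j) \in S) = (nth 0 mu i <= j < g i).
  apply/idP/idP => [ijS|/Sin//].
  have := SD _ ijS; rewrite mem_boxes => /andP[mj jl]; rewrite mj /= ltnNge.
  apply/negP => gj; have glt : g i < nth 0 la i by lia.
  have hs : has (fun j => (i, j) \notin S) (r i).
    by rewrite has_find [size _]size_iota ltn_subRL.
  have := nth_find (nth 0 mu i) hs; rewrite nth_iota; last by rewrite ltn_subRL.
  move/negP; apply; apply: (down _ _ (j - g i)); first exact: leq_addr.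
  by rewrite -/(g i) subnKC.
(* Otherwise the last box of [S] in row [i.+1] would have a box of the diagram directly above it. *)
have gd i : g i.+1 <= g i.
  have mg l : nth 0 mu l <= g l by rewrite /g leq_addr.
  rewrite leqNgt; apply/negP => lt.
  have m1 := intpart_nth mu (leqnSn i); have l1 := intpart_nth la (leqnSn i).
  have bS : (i.+1, (g i.+1).-1) \in S.
    by rewrite SE; have := mg i; have := mg i.+1; lia.
  have bD : (i, (g i.+1).-1) \in boxes la mu.
    by rewrite mem_boxes; have := mg i; have := gle i.+1; lia.
  by have [_ /negP[]] := hS _ _ bS bD; rewrite /above /=.
have [|eta etaE] := intpart_of (n := size la) gd.
  by move=> i li; apply/eqP; rewrite -leqn0 -[0](nth_default 0 li).
have SB : S = boxes eta mu.
  by apply/fsetP => -[i j]; rewrite mem_boxes SE etaE.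
have me : included mu eta by apply/includedP => i; rewrite etaE leq_addr.
exists eta; split=> //.
- by rewrite -boxes_eq0 // -SB.
- by apply/includedP => i; rewrite etaE.
apply/hstripP; rewrite -SB => i i' j.
wlog lt : i i' / i < i' => [hw iS i'S|].
  by case: (ltngtP i i') => // lt; [apply: hw|apply/esym/hw].
move=> iS i'S; case: i' lt i'S => // i' lt i'S.
(* With two boxes of [S] in one column, the position just above the lower one is in the diagram
   because the parts of both partitions decrease. *)
have bD : (i', j) \in boxes la mu.
  move: (SD _ iS) (SD _ i'S); rewrite !mem_boxes.
  by have := intpart_nth mu (ltnSE lt); have := intpart_nth la (leqnSn i'); lia.
by have [_ /negP[]] := hS _ _ i'S bD; rewrite /above /=.
Qed.

(** Removing the first strip replaces the inner partition by the next one of the chain and keeps the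
    outer one, whence the induction for all [mu]. *)
Lemma SSD_chain (s : Defs.skew) Ds : SSD s Ds <-> strip_chain (diagram s) Ds.
Proof.
rewrite /SSD /diagram; have ml := valP s; rewrite -/(inner s) -/(outer s) in ml.
move: (inner s) (outer s) ml => mu la {s} ml.
elim: Ds mu ml => [|S Ds IHDs] mu ml /=.
  split=> [[[|eta etas] //= ]|]; rewrite boxes_eq0 //.
  by move=> E; exists [::].
split=> [[[|eta etas] //= /andP[/andP[/and3P[ne me hs] pe] le] [<- E]]|/andP[hS hc]].
  have el : included eta la.
    move: pe le => {E hs ne me}; elim: etas eta => [|e etas IHe] eta /=.
      by move=> _ /eqP ->; apply/includedP.
    move=> /andP[/and3P[_ h1 _] pe] le; apply: included_trans h1 _.
    exact: IHe.
  rewrite hstrip_strip //= boxesD //; apply/IHDs => //.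
  by exists etas => /=; rewrite ?pe ?le.
have [eta [ne me el hs SE]] := strip_hstrip ml hS.
move: hc; rewrite SE boxesD // => /(IHDs _ el)[etas /= /andP[pe le] <-].
by exists (eta :: etas); rewrite //= ne me hs pe.
Qed.

End Partitions.

(** * Linearization of a tableau and of its pieces *)

Section TableauLinearization.
Context (k : comNzRingType) (A : countType).
Local Notation kA := {malg k[A]}.
Local Notation kW := {malg k[{fmonom A}]}.
Variable diam : {bilinear kA -> kA -> kA}.
Hypotheses (diamC : commutative diam) (diamA : associative diam).
Implicit Type h : tableau A.

(** A total function on positions, with value 0 outside the diagram, so that subsets and translates
    of diagrams need no dependent types. *)
Definition label h (b : nat * nat) : kA :=
  if @insub _ _ (diagram (tag h) : Type) b is Some x then letter k (tagged h x) else 0.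

Lemma label_val h (x : diagram (tag h)) : label h (val x) = letter k (tagged h x).
Proof. by rewrite /label valK. Qed.

Definition tab_lin h (D : {fset nat * nat}) : kW :=
  strip_lin left_of above (@cons_word k A) (word k [::]) diamC diamA (label h) D.

Lemma diam_prodE (s : seq kA) : s <> [::] ->
  \big[oAC diamA diamC/None]_(x <- s) Some x = Some (diam_prod diam s).
Proof.
case: s => // x s _ /=; rewrite big_cons.
elim: s x => [|y s IHs] x; first by rewrite big_nil.
by rewrite big_cons /= -IHs Monoid.mulmA.
Qed.

Lemma strip_prodE h (D : {fset nat * nat}) :
  (D `<=` diagram (tag h))%fset -> D != fset0 ->
  strip_prod diam h D = dm_prod diamC diamA (label h) D.
Proof.
move=> DE D0; apply: Some_inj; rewrite -dm_prodE // -diam_prodE; last first.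
  have /fset0Pn[b bD] := D0; have bE := fsubsetP DE _ bD.
  move=> /(congr1 size)/eqP; rewrite /= size_map size_filter -leqn0 leqNgt -has_count.
  by move/hasP; apply; exists [` bE]%fset; rewrite ?mem_enum.
rewrite big_map big_filter big_enum_cond /=.
under eq_bigr do rewrite -/(letter k _) -label_val.
rewrite -(big_seq_fsetE _ (diagram (tag h)) (fun b => b \in D)
  (fun b => Some (label h b))).
rewrite -big_filter; apply: perm_big.
apply: uniq_perm; rewrite ?filter_uniq ?fset_uniq // => b.
rewrite mem_filter; have [bD|//] := boolP (b \in D).
by rewrite (fsubsetP DE).
Qed.

Lemma linearizeE h : linearize diam h = tab_lin h (diagram (tag h)).
Proof.
pose D := diagram (tag h); pose cs := chains left_of above #|` D|%fset D.
have csE Ds : (Ds \in cs) = strip_chain left_of above D Ds by apply: mem_chains.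
have SE : SSD (tag h) = [set` cs]%classic.
  by apply/seteqP; split=> Ds /=; rewrite csE => /SSD_chain.
rewrite /linearize SE -fsbig_seq; last exact: uniq_chains.
rewrite /tab_lin strip_lin_chains; last exact: cons_word_linr.
apply: eq_big_seq => Ds; rewrite csE.
(* Removing strips changes [D] but not [h], so the induction runs over all subsets of the
   diagram. *)
have : (D `<=` diagram (tag h))%fset by [].
elim: Ds D {cs csE SE} => [|S Ds IHDs] D DE /= => [_|/andP[hS hDs]].
  by rewrite big_nil word_nil.
rewrite big_cons (IHDs _ _ hDs); last by apply: fsubset_trans (fsubsetDl _ _) DE.
rewrite strip_prodE //; last by move: hS; rewrite mem_nstrips => /andP[].
exact: fsubset_trans (nstrips_sub hS) DE.
Qed.

Lemma tab_linU h (D1 D2 : {fset nat * nat}) : unrelated left_of above D1 D2 ->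
  tab_lin h (D1 `|` D2)%fset = qsh diam (tab_lin h D1) (tab_lin h D2).
Proof.
apply: (@strip_linU k kA kW _ _ _ _ _ _ _ _ (qsh diam)).
- exact: qsh_linl.
- exact: qsh_linr.
- by rewrite word_nil => x; apply: qsh1l.
- by rewrite word_nil => x; rewrite qshC // qsh1l.
- exact: qsh_cons.
- exact: cons_word_linr.
Qed.

Lemma tab_lin_translate h h' a c (D : {fset nat * nat}) :
    {in D, forall b, label h' (b.1 + a, b.2 + c)%N = label h b} ->
  tab_lin h' [fset ((b.1 + a)%N, (b.2 + c)%N) | b in D]%fset = tab_lin h D.
Proof.
apply: strip_lin_imfset.
- by move=> [i j] [i' j'] /= [/addIn -> /addIn ->].
- by move=> [i j] [i' j']; rewrite /left_of /= !xpair_eqE -addSn !eqn_add2r.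
- by move=> [i j] [i' j']; rewrite /above /= !xpair_eqE -addSn !eqn_add2r.
Qed.

Definition row_range h a b : {fset nat * nat} :=
  [fset x in diagram (tag h) | (a <= x.1 < b)%N]%fset.

Lemma mem_row_range h a b x :
  (x \in row_range h a b) = (x \in diagram (tag h)) && (a <= x.1 < b)%N.
Proof. by rewrite !inE. Qed.

Lemma linearize_piece h a b :
  linearize diam (piece h a b) = tab_lin h (row_range h a b).
Proof.
rewrite linearizeE; set c := nth 0%N (inner (tag h)) b.-1.
rewrite -(@tab_lin_translate (piece h a b) h a c).
  congr tab_lin; apply/fsetP => -[i j]; rewrite mem_row_range.
  apply/imfsetP/andP => [[[i' j'] /= + [-> ->]]|[/= ijD ab]].
    rewrite !mem_boxes !nth_cut_rows -/c.
    case: ifP => // lt; rewrite [(a + i')%N]addnC; lia.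
  move: ijD; rewrite mem_boxes => ijD.
  (* The shift is the inner part of the last row of the piece, the smallest one, so the truncated
     subtraction of columns is exact. *)
  have cj : (c <= nth 0%N (inner (tag h)) i)%N by apply: intpart_nth; lia.
  exists ((i - a)%N, (j - c)%N) => /=; last by congr (_, _); lia.
  rewrite mem_boxes !nth_cut_rows -/c; case: ifP => [lt|]; last by lia.
  by rewrite subnKC; lia.
move=> x xD; pose y : diagram (tag (piece h a b)) := [` xD]%fset.
rewrite -[x in RHS]/(val y) label_val /= ffunE.
exact: (label_val [` cut_skew_box y]%fset).
Qed.

Definition cut_points (la mu : seq nat) : seq nat :=
  [seq i.+1 | i <- iota 0 (size la) & (nth 0%N la i.+1 <= nth 0%N mu i)%N].

(** The outer part past the last row is 0, so there is always a cut after the last row and the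
    pieces exhaust the diagram. *)
Lemma last_cut_points (la mu : seq nat) : last 0%N (cut_points la mu) = size la.
Proof.
rewrite /cut_points; case E: (size la) => [//|n].
rewrite -addn1 iotaD filter_cat map_cat last_cat /= add0n.
by rewrite [nth 0%N la _]nth_default ?E //= addn1.
Qed.

Lemma sorted_cut_points (la mu : seq nat) : sorted ltn (cut_points la mu).
Proof.
apply: (@homo_sorted _ _ _ ltn) => [i j|]; first by [].
by apply: sorted_filter (iota_ltn_sorted _ _); apply: ltn_trans.
Qed.

(** The pieces are split off from the top. A cut leaves the boxes above it strictly to the right of
    those below, so the two parts are unrelated. *)
Lemma linearize_SC h :
  linearize diam h = foldr (qsh diam) (word k [::]) [seq linearize diam i | i <- SC h].
Proof.
rewrite linearizeE; set D := diagram (tag h).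
set la := outer (tag h); set mu := inner (tag h).
rewrite /SC -/la -/mu -/(cut_points la mu).
have rowD i j : (i, j) \in D -> (i < size la)%N.
  rewrite mem_boxes => /andP[_]; case: (ltnP i (size la)) => // le.
  by rewrite nth_default.
(* The part of the diagram left after the pieces above row [a]; the starting row 0 is generalized to
   [a] for the induction on the cuts. *)
pose from a : {fset nat * nat} := [fset x in D | (a <= x.1)%N]%fset.
have mem_from a x : (x \in from a) = (x \in D) && (a <= x.1)%N by rewrite !inE.
have from0 : D = from 0%N by apply/fsetP => x; rewrite mem_from andbT.
have cutP c :
    c \in cut_points la mu -> (0 < c)%N && (nth 0%N la c <= nth 0%N mu c.-1)%N.
  by case/mapP => i; rewrite mem_filter => /andP[+ _] ->.
have : path ltn 0%N (cut_points la mu).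
  have := sorted_cut_points la mu.
  have : all (fun c => 0 < c)%N (cut_points la mu).
    by apply/allP => c /cutP/andP[].
  by case: (cut_points la mu) => //= c r /andP[-> _] ->.
have := last_cut_points la mu.
rewrite [in tab_lin h D]from0; move: (cut_points la mu) cutP {1 2 3 4}0%N => r.
elim: r => [|c r IHr] cutP a /=.
  move=> aE _; have -> : from a = fset0.
    apply/fsetP => -[i j]; rewrite mem_from inE; apply/negP => /andP[ijD ai].
    by move: ai (rowD _ _ ijD) => /=; rewrite aE; lia.
  exact: strip_lin0.
move=> lastE /andP[ac pc]; rewrite linearize_piece -IHr //; last first.
  by move=> c' c'r; apply: cutP; rewrite inE c'r orbT.
have -> : from a = (row_range h a c `|` from c)%fset.
  apply/fsetP => -[i j]; rewrite inE mem_row_range !mem_from /=.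
  by case: ((i, j) \in D) => //=; lia.
apply: tab_linU => -[i j] [i' j']; rewrite mem_row_range mem_from /=.
move=> /andP[ijD /andP[ai ic]] /andP[ijD' ci'].
have /andP[c0 cut] := cutP c (mem_head _ _).
have ic' : (i <= c.-1)%N by lia.
(* The chain is [j' < la_i' <= la_c <= mu_(c-1) <= mu_i <= j], its middle inequality being the
   condition for a cut. *)
have jj : (j' < j)%N.
  have := intpart_nth mu ic'; have := intpart_nth la ci'.
  by move: ijD ijD'; rewrite !mem_boxes -/la -/mu; lia.
by rewrite /left_of /above /= !xpair_eqE; split; lia.
Qed.

End TableauLinearization.

(** * The algebra of tableaux *)

Section Morphisms.
Context (k : comNzRingType).

Lemma exists_lrmorphism (R Q : comAlgType k) (g : R -> Q) :
  plinear g -> g 1 = 1 -> (forall x y, g (x * y) = g x * g y) ->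
  exists G : {lrmorphism R -> Q}, forall x, G x = g x.
Proof.
move=> gl g1 gM.
pose gL := GRing.isLinear.Build k R Q *:%R g gl.
pose gm := GRing.isMonoidMorphism.Build R Q g (g1, gM).
by exists (HB.pack_for {lrmorphism R -> Q} g gL gm).
Qed.

Lemma exists_linear (U V : lmodType k) (g : U -> V) :
  plinear g -> exists G : {linear U -> V}, forall x, G x = g x.
Proof.
move=> gl; pose gL := GRing.isLinear.Build k U V *:%R g gl.
by exists (HB.pack_for {linear U -> V} g gL).
Qed.

Lemma pi_quot_plinear (R : comAlgType k) (I : idealr R) :
  plinear (fun x : R => (\pi_{ideal_quot I} x)%qT).
Proof.
move=> c x y; rewrite rmorphD; congr (_ + _).
exact/esym/pi_scale.
Qed.

Lemma exists_quot_lift (R Q : comAlgType k) (I : idealr R) (g : {lrmorphism R -> Q}) :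
  (forall x, x \in I -> g x = 0) ->
  exists G : {lrmorphism {ideal_quot I} -> Q},
    forall x, G (\pi_{ideal_quot I} x)%qT = g x.
Proof.
move=> g0; pose F (x : {ideal_quot I}) : Q := g (repr x).
have FE x : F (\pi_{ideal_quot I} x)%qT = g x.
  apply/eqP; rewrite -subr_eq0 -rmorphB; apply/eqP/g0.
  have := Quotient.idealrBE I (repr (\pi_{ideal_quot I} x)%qT) x.
  by rewrite reprK eqxx.
have [|||G GE] := @exists_lrmorphism {ideal_quot I} Q F.
- move=> c x y; have [[u ->] [v ->]] := (quot_piP x, quot_piP y).
  by rewrite -pi_quot_plinear !FE linearP.
- by rewrite -[1](rmorph1 (\pi_{ideal_quot I})%qT) FE rmorph1.
- move=> x y; have [[u ->] [v ->]] := (quot_piP x, quot_piP y).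
  by rewrite -[_ * _]rmorphM !FE rmorphM.
by exists G => x; rewrite GE.
Qed.

Lemma cmonom_ind (I : choiceType) (Pr : {cmonom I} -> Prop) :
  Pr mone -> (forall i m, Pr m -> Pr (mmul (ucm i) m)) -> forall m, Pr m.
Proof.
move=> P1 PM m; have [n] := ubnP (mdeg m); elim: n m => // n IHn m lt.
have [->//|m1] := eqVneq m mone.
have : finsupp m != fset0.
  apply: contraNneq m1 => m0; apply/eqP/mdeg_eq0I.
  by rewrite mdegE m0 big_seq_fset0.
move=> /fset0Pn[i im]; have mE : m = mmul (ucm i) (divcm m (ucm i)).
  apply/eqP/cmP => j; rewrite cmM divcmE subnKC // ucmE.
  by have [<-|//] := eqVneq i j; rewrite lt0n cmE_neq0.
rewrite mE; apply: PM; apply: IHn.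
by move: lt; rewrite {1}mE mdegM mdegU.
Qed.

(** The universal property of a polynomial algebra: [psi] evaluates monomials and is extended
    linearly. *)
Lemma exists_free_lift (I : choiceType) (Q : comAlgType k) (v : I -> Q) :
  exists G : {lrmorphism {malg k[{cmonom I}]} -> Q}, forall i, G << ucm i >> = v i.
Proof.
pose psi (m : {cmonom I}) : Q := \prod_(i <- finsupp m) v i ^+ m i.
(* Enlarging the index set lets two monomials be multiplied over a common support. *)
have psiE (d : {fset I}) (m : {cmonom I}) :
    (finsupp m `<=` d)%fset -> psi m = \prod_(i <- d) v i ^+ m i.
  by move=> le; apply: big_fset_incl => // i _; rewrite -cmE_eq0 => /eqP ->; rewrite expr0.
have psiM m1 m2 : psi (mmul m1 m2) = psi m1 * psi m2.
  rewrite (psiE _ _ (fsubset_refl _)) mdomD.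
  rewrite (psiE _ m1 (fsubsetUl _ (finsupp m2))) (psiE _ m2 (fsubsetUr (finsupp m1) _)).
  by rewrite -big_split; apply: eq_bigr => i _; rewrite cmM exprD.
have psi1 : psi mone = 1 by rewrite /psi mdom1 big_seq_fset0.
have psiU i : psi (ucm i) = v i by rewrite /psi mdomU big_seq_fset1 cmUU expr1.
have gl : plinear (mlift psi) by exact: mlift_plinear.
have sp := @malg_lin_ind k {cmonom I}.
have [|||G GE] := @exists_lrmorphism _ Q (mlift psi).
- exact: gl.
- exact: etrans (mliftU _ _) psi1.
- move=> x y; pose M : comAlgType k := {malg k[{cmonom I}]}.
  move: x; apply: (@plinear_ext k M Q _ _ _ _ sp) => [||m1].
  + exact: plinear_comp gl (@plinear_mull k M y).
  + exact: plinear_comp (plinear_mull _) gl.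
  move: y; apply: (@plinear_ext k M Q _ _ _ _ sp) => [||m2].
  + exact: plinear_comp gl (@plinear_mulr k M _).
  + exact: plinear_comp (plinear_mulr _) gl.
  have E : << m1 >> * << m2 >> = << mmul m1 m2 >> :> M.
    by rewrite [LHS]malgM_def fgmulUU mulr1.
  transitivity (psi m1 * psi m2); last by congr (_ * _); apply/esym/mliftU.
  by rewrite -psiM -[RHS]mliftU -E.
by exists G => i; rewrite GE (mliftU psi (ucm i)).
Qed.

End Morphisms.

(** * Existence of the linearization morphism *)

Section LinearizationSpec.
Context (k : comNzRingType) (A : countType).
Local Notation kA := {malg k[A]}.
Local Notation kW := {malg k[{fmonom A}]}.
Variable diam : {bilinear kA -> kA -> kA}.
Hypotheses (diamC : commutative diam) (diamA : associative diam).

(** This rules out the junk branch of [linearization]: the morphism from the polynomial algebra to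
    the quasi-shuffle algebra kills the relations by [linearize_SC]. *)
Lemma exists_linearization :
  exists L : qsh_morphism diam, forall h, L (tab_cls k h) = linearize diam h.
Proof.
pose Q : comAlgType k := qsh_alg diamC diamA.
have [G0 G0E] := @exists_free_lift k (tableau A) Q (linearize diam).
have prodE (r : seq (tableau A)) : \prod_(i <- r) G0 (tab_gen k i) =
    foldr (qsh diam) (word k [::]) [seq linearize diam i | i <- r].
  elim: r => [|i r IHr]; first by rewrite big_nil; apply/esym/word_nil.
  by rewrite big_cons; apply: (congr2 (qsh diam) (G0E i) IHr).
have G0rel (h : tableau A) : G0 (SC_rel k h) = 0.
  have E : G0 (tab_gen k h) = \prod_(i <- SC h) G0 (tab_gen k i).
    by apply: etrans (G0E h) (etrans _ (esym (prodE _))); apply: linearize_SC.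
  rewrite /SC_rel rmorphB rmorph_prod.
  exact: etrans (congr1 (fun z : Q => z - _) E) (subrr _).
have [G GE] : exists G : {lrmorphism tab_alg k A -> Q},
    forall x, G (\pi_(tab_alg k A) x)%qT = G0 x.
  apply: exists_quot_lift => x; exact: gen_ideal_ker G0rel.
(* The algebra [Q] and k<A> have the same underlying module, so [G] is repackaged as a linear map to
   the latter. *)
have [L LE] : exists L : {linear tab_alg k A -> kW}, forall x, L x = G x.
  by apply: exists_linear => c x y; rewrite linearP.
have L1 : L 1 = 1 by rewrite LE rmorph1.
have LM x y : L (x * y) = qsh diam (L x) (L y) by rewrite !LE rmorphM.
by exists (QshMorphism L1 LM) => h; rewrite /= LE GE G0E.
Qed.

Lemma linearization_tab h : linearization diam (tab_cls k h) = linearize diam h.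
Proof.
rewrite /linearization; case: pselect => [exL|]; first by case: cid.
by case/(_ exists_linearization).
Qed.

End LinearizationSpec.

(** * Evaluation of words and the Schur sum *)

Section WordEvaluation.
Context (k : comNzRingType) (A : countType).
Local Notation kA := {malg k[A]}.
Local Notation kW := {malg k[{fmonom A}]}.
Context (diam : {bilinear kA -> kA -> kA}) (P : comAlgType k).
Context (d : Order.disp_t) (X : finOrderType d) (f : X -> {linear kA -> P}).

(* The sum of f_{m_1}(a_1) ... f_{m_n}(a_n) over the subsequences m_1 ... m_n of
   [s], for the word a_1 ... a_n. *)
Fixpoint word_sum (s : seq X) (u : seq A) : P :=
  match u, s with
  | [::], _ => 1
  | _ :: _, [::] => 0
  | a :: u', m :: s' => f m (letter k a) * word_sum s' u' + word_sum s' u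
  end.

Definition word_eval s : kW -> P := mlift (fun u : {fmonom A} => word_sum s u).

Lemma word_eval_plinear s : plinear (word_eval s).
Proof. exact: mlift_plinear. Qed.

Lemma word_eval_word s u : word_eval s (word k u) = word_sum s u.
Proof. by rewrite /word_eval mliftU. Qed.

Lemma word_eval1 s : word_eval s (word k [::]) = 1.
Proof. by rewrite word_eval_word; case: s. Qed.

Lemma plinear_f m : plinear (f m).
Proof. by move=> c x y; rewrite linearP. Qed.

Lemma word_eval_nil_cons x p : word_eval [::] (cons_word x p) = 0.
Proof.
have zl (Z : lmodType k) : plinear (fun _ : Z => 0 : P).
  by move=> c y z; rewrite scaler0 addr0.
move: x.
apply: (@plinear_ext k kA P _ (letter k (A := A)) _ _ (@spans_letter k A)) => [||a].
- exact: plinear_comp (word_eval_plinear _) (cons_word_linl p).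
- exact: zl.
move: p.
apply: (@plinear_ext k kW P _ (word k (A := A)) _ _ (@spans_word k A)) => [||u].
- exact: plinear_comp (word_eval_plinear _) (cons_word_linr _).
- exact: zl.
by rewrite -word_cons word_eval_word.
Qed.

Lemma word_eval_cons m s x p :
  word_eval (m :: s) (cons_word x p) =
    f m x * word_eval s p + word_eval s (cons_word x p).
Proof.
move: x.
apply: (@plinear_ext k kA P _ (letter k (A := A)) _ _ (@spans_letter k A)) => [||a].
- exact: plinear_comp (word_eval_plinear _) (cons_word_linl p).
- apply: plinear_add.
    exact: plinear_comp (plinear_mull _) (plinear_f m).
  exact: plinear_comp (word_eval_plinear _) (cons_word_linl p).
move: p.
apply: (@plinear_ext k kW P _ (word k (A := A)) _ _ (@spans_word k A)) => [||u].
- exact: plinear_comp (word_eval_plinear _) (cons_word_linr _).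
- apply: plinear_add.
    exact: plinear_comp (plinear_mulr _) (word_eval_plinear _).
  exact: plinear_comp (word_eval_plinear _) (cons_word_linr _).
by rewrite -word_cons !word_eval_word.
Qed.

Hypothesis fM : forall (m : X) (x y : kA), f m (diam x y) = f m x * f m y.

Lemma word_evalM s x y : word_eval s (qsh diam x y) = word_eval s x * word_eval s y.
Proof.
apply: (@abs_evalM k kA kW A (word k (A := A)) (letter k (A := A)) (@cons_word k A)
  diam (qsh diam) P X f word_eval).
- exact: spans_word.
- exact: qsh_linl.
- exact: qsh_linr.
- exact: qsh_1word.
- exact: qsh_word1.
- exact: word_cons.
- exact: qsh_cons_word.
- exact: word_eval_plinear.
- exact: word_eval1.
- exact: word_eval_nil_cons.
- exact: word_eval_cons.
- exact: fM.
Qed.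

Hypotheses (diamC : commutative diam) (diamA : associative diam).

Definition alphabet : seq X := sort <=%O (enum X).

Lemma alphabet_sorted : sorted <%O alphabet.
Proof. by rewrite sort_lt_sorted enum_uniq. Qed.

Lemma mem_alphabet x : x \in alphabet.
Proof. by rewrite mem_sort mem_enum. Qed.

Lemma schurE (h : tableau A) (m0 : {ffun diagram (tag h) -> X}) :
  word_eval alphabet (linearize diam h) = schur f h.
Proof.
rewrite (linearizeE diamC diamA) /tab_lin.
rewrite (@ev_strip_lin k kA kW _ left_of above (@cons_word k A) (word k [::]) diam
  diamC diamA d X (diagram (tag h)) (label k h) P f word_eval word_eval_plinear
  word_eval1 word_eval_nil_cons word_eval_cons fM alphabet (diagram (tag h)) m0
  alphabet_sorted (fsubset_refl _)).
apply: eq_big => [m|m _].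
  apply/fillingP/andP => [[_ h2]|[/forallP h1 /forallP h2]]; split.
  - apply/forallP => b; apply/forallP => b'; apply/implyP => bb'.
    by have [+ _] := h2 b' b (valP b') (valP b); apply.
  - apply/forallP => b; apply/forallP => b'; apply/implyP => bb'.
    by have [_ +] := h2 b' b (valP b') (valP b); apply.
  - by move=> t; rewrite (valP t) mem_alphabet.
  move=> t t' _ _; split=> tt'.
    by have /forallP/(_ t)/implyP := h1 t'; apply.
  by have /forallP/(_ t)/implyP := h2 t'; apply.
apply: eq_big => [t|t _]; first by rewrite (valP t).
by rewrite label_val.
Qed.

(** A function from the diagram to [X] exists unless [X] is empty and the diagram is not; in that
    case both sides vanish. *)
Lemma word_eval_schur (h : tableau A) :
  word_eval alphabet (linearize diam h) = schur f h.
Proof.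
case E: alphabet => [|x s]; last by rewrite -E; apply: schurE; exact: [ffun=> x].
rewrite -E; have [D0|D0] := eqVneq (diagram (tag h)) fset0.
  have nD (b : diagram (tag h)) : False.
    by have /fsetP/(_ (val b)) := D0; rewrite inE (valP b).
  by apply: schurE; refine [ffun b => _]; case: (nD b).
have /fset0Pn[b bD] := D0.
rewrite E (linearizeE diamC diamA) /tab_lin ev_strip_lin_nil //; last first.
- exact: word_eval_nil_cons.
- exact: word_eval_plinear.
rewrite /schur big1 // => m _.
by have := mem_alphabet (m [` bD]%fset); rewrite E.
Qed.

End WordEvaluation.

(** * Products of tableaux as single stacked tableaux *)

Section Stacking.
Context (k : comNzRingType) (A : countType).
Local Notation kA := {malg k[A]}.
Variable diam : {bilinear kA -> kA -> kA}.
Hypotheses (diamC : commutative diam) (diamA : associative diam).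

Lemma exists_empty_tableau : exists h : tableau A, linearize diam h = 1.
Proof.
have nil_int : is_intpart [::] by [].
pose nl := IntPart nil_int.
have inc : included nl nl by [].
pose s : Defs.skew := exist _ (nl, nl) inc.
have D0 : diagram s = fset0 by apply/fsetP => -[i j]; rewrite mem_boxes inE /= nth_nil.
(* The filling is vacuous, which also covers an empty [A]. *)
have nD (b : diagram s) : A.
  by have /fsetP/(_ (val b)) := D0; rewrite inE (valP b).
pose h : tableau A :=
  Tagged (fun s => {ffun diagram s -> A}) [ffun b : diagram s => nD b].
exists h; rewrite (linearizeE diamC diamA) -[diagram (tag h)]/(diagram s) D0.
by rewrite /tab_lin strip_lin0 word_nil.
Qed.

(* [h1] is placed to the upper right of [h2], out of its rows and columns. *)
Lemma exists_stack (h1 h2 : tableau A) : exists h : tableau A,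
  linearize diam h = qsh diam (linearize diam h1) (linearize diam h2).
Proof.
pose la1 := outer (tag h1); pose mu1 := inner (tag h1).
pose la2 := outer (tag h2); pose mu2 := inner (tag h2).
(* [h1] moves right by the longest outer row [c] of [h2], and [h2] moves down by the [r] rows of
   [h1]. *)
pose r := size la1; pose c := nth 0%N la2 0.
pose join (p q : intpart) i :=
  if (i < r)%N then (nth 0 p i + c)%N else nth 0%N q (i - r).
(* The joined sequence still decreases at row [r] because the first part of [q] is at most [c]. *)
have joinP (p q : intpart) : (nth 0 q 0 <= c)%N -> (size q <= size la2)%N ->
    exists la : intpart, forall i, nth 0%N la i = join p q i.
  move=> qc sq; apply: (@intpart_of _ (r + size la2)) => i; rewrite /join.
    case: (ltnP i.+1 r) => lt1; case: (ltnP i r) => lt2; try lia.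
    - by rewrite leq_add2r intpart_nth.
    - apply: leq_trans (_ : c <= _)%N; last exact: leq_addl.
      by apply: leq_trans qc; apply: intpart_nth.
    - by apply: intpart_nth; lia.
  move=> le; rewrite ltnNge (leq_trans (leq_addr _ _) le) /= nth_default //; lia.
have inc2 i : (nth 0 mu2 i <= nth 0 la2 i)%N by apply: included_nth (valP (tag h2)).
have inc1 i : (nth 0 mu1 i <= nth 0 la1 i)%N by apply: included_nth (valP (tag h1)).
have sz2 : (size mu2 <= size la2)%N.
  rewrite leqNgt; apply/negP => lt; have /andP[_ /negP[]] := valP mu2.
  have := mem_nth 0%N lt; have := inc2 (size la2).
  by rewrite [nth 0%N la2 _]nth_default // leqn0 => /eqP ->.
have [la laE] := joinP la1 la2 (leqnn _) (leqnn _).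
have [mu muE] := joinP mu1 mu2 (inc2 0%N) sz2.
have inc : included mu la.
  apply/includedP => i; rewrite laE muE /join.
  by case: ifP => _; rewrite ?leq_add2r ?inc1 ?inc2.
pose s : Defs.skew := exist _ (la, mu) inc.
pose D1 := diagram (tag h1); pose D2 := diagram (tag h2).
pose D1' : {fset nat * nat} := [fset ((b.1 + 0)%N, (b.2 + c)%N) | b in D1]%fset.
pose D2' : {fset nat * nat} := [fset ((b.1 + r)%N, (b.2 + 0)%N) | b in D2]%fset.
have row1 i j : (i, j) \in D1 -> (i < r)%N.
  rewrite mem_boxes => /andP[_]; case: (ltnP i r) => // le.
  by rewrite nth_default.
have mem1 i j : ((i, j) \in D1') = [&& (i < r)%N, (c <= j)%N & (i, (j - c)%N) \in D1].
  apply/imfsetP/and3P => [[[i' j'] /= + [-> ->]]|[ir cj ijD]].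
    by rewrite addn0 addnK leq_addl => ijD; rewrite (row1 _ _ ijD).
  by exists (i, (j - c)%N) => //=; rewrite addn0 subnK.
have mem2 i j : ((i, j) \in D2') = (r <= i)%N && (((i - r)%N, j) \in D2).
  apply/imfsetP/andP => [[[i' j'] /= + [-> ->]]|[ir ijD]].
    by rewrite addn0 addnK leq_addl.
  by exists ((i - r)%N, j) => //=; rewrite addn0 subnK.
have DE : diagram s = (D1' `|` D2')%fset.
  apply/fsetP => -[i j]; rewrite inE mem1 mem2 !mem_boxes laE muE /join.
  rewrite -/la1 -/mu1 -/la2 -/mu2.
  by case: (ltnP i r) => lt /=; rewrite ?orbF; lia.
have memD x : (x \in diagram s) = (x \in D1') || (x \in D2') by rewrite DE inE.
pose lb (b : nat * nat) : kA :=
  if (b.1 < r)%N then label k h1 (b.1, b.2 - c)%N else label k h2 (b.1 - r, b.2)%N.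
have labA (h : tableau A) b :
    b \in diagram (tag h) -> exists a, label k h b = letter k a.
  by move=> bD; exists (tagged h [` bD]%fset); rewrite -label_val.
have lbA (b : diagram s) : exists a, lb (val b) = letter k a.
  have := valP b; case: (val b) => i j; rewrite memD mem1 mem2 /lb /=.
  case: ltnP => lt /=; last by apply: labA.
  by rewrite orbF => /andP[_]; apply: labA.
(* Labels lie in kA; each of these is a letter, so finite choice recovers entries in [A]. *)
have [g gE] := fin_all_exists lbA.
pose h : tableau A :=
  Tagged (fun s => {ffun diagram s -> A}) [ffun b : diagram s => g b].
have hE b : b \in diagram s -> label k h b = lb b.
  move=> bD; rewrite -[b in LHS]/(val ([` bD]%fset : diagram (tag h))) label_val ffunE.
  by rewrite -gE.
exists h; rewrite !(linearizeE diamC diamA) -[diagram (tag h)]/(diagram s) DE.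
transitivity (qsh diam (tab_lin diamC diamA h D1') (tab_lin diamC diamA h D2')).
  apply: tab_linU.
  move=> [i j] [i' j']; rewrite mem1 mem2 => /and3P[ir cj _] /andP[ri].
  rewrite mem_boxes => /andP[_ jl].
  have := intpart_nth la2 (leq0n (i' - r)); rewrite -/c => l0.
  have jj : (j' < j)%N by apply: leq_trans cj; apply: leq_trans jl l0.
  by rewrite /left_of /above /= !xpair_eqE; split; lia.
apply: (congr2 (qsh diam)).
  apply: tab_lin_translate => -[i j] ijD /=.
  have ijD' : (i + 0, j + c)%N \in D1'.
    by rewrite mem1 addn0 addnK leq_addl (row1 _ _ ijD).
  rewrite hE /lb /= ?addn0 ?(row1 _ _ ijD) ?addnK //.
  by rewrite memD -{1}[i]addn0 ijD'.
apply: tab_lin_translate => -[i j] ijD /=.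
have ijD' : (i + r, j + 0)%N \in D2'.
  by rewrite mem2 addn0 addnK leq_addl.
rewrite hE /lb /= ?addn0 ?addnK ?ltnNge ?leq_addl //.
by rewrite memD -{2}[j]addn0 ijD' orbT.
Qed.

Lemma lin_quot_eq (x y : tab_alg k A) : linearization diam x = linearization diam y ->
  (\pi_(lin_alg diam) x)%qT = (\pi_(lin_alg diam) y)%qT.
Proof.
move=> E; apply/eqP; rewrite piE Quotient.equivE.
by rewrite /in_mem /= /ker_linearization linearB E subrr.
Qed.

End Stacking.

(** Used for uniqueness among linear maps, where values on products of tableaux are not given. *)
Lemma spans_lin_cls (k : comNzRingType) (A : countType)
    (diam : {bilinear {malg k[A]} -> {malg k[A]} -> {malg k[A]}}) :
  commutative diam -> associative diam -> spans (@lin_cls k A diam).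
Proof.
move=> diamC diamA Pr P0 PD P1 x.
pose pi2 (z : {malg k[{cmonom tableau A}]}) : lin_alg diam :=
  (\pi_(lin_alg diam) (\pi_(tab_alg k A) z))%qT.
have [y ->] := quot_piP x; have [{}y ->] := quot_piP y.
have pi2l : plinear pi2.
  exact: plinear_comp (@pi_quot_plinear k (tab_alg k A) _) (@pi_quot_plinear k _ _).
apply: (@malg_lin_ind k _ (fun z => Pr (pi2 z))) y => [|c u v|m].
- by rewrite (plinear0 pi2l).
- by rewrite pi2l; apply: PD.
(* Elements with the same linearization coincide in the quotient, so it is enough to match a
   monomial with one tableau. *)
suff [h hE] : exists h : tableau A,
    linearization diam (\pi_(tab_alg k A) << m >>)%qT = linearize diam h.
  have -> : pi2 << m >> = lin_cls diam h; last exact: P1.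
  exact: lin_quot_eq (etrans hE (esym (linearization_tab diamC diamA h))).
elim/cmonom_ind: m => [|i m [h hE]].
  have [h hE] := exists_empty_tableau diamC diamA; exists h.
  have pi1 : (\pi_(tab_alg k A) << mone >>)%qT = 1 by apply: rmorph1.
  apply: etrans (congr1 (linearization diam) pi1) _.
  exact: etrans (qsh_morphism1 _) (esym hE).
have [h' h'E] := exists_stack diamC diamA i h; exists h'.
have piM : (\pi_(tab_alg k A) << mmul (ucm i) m >>)%qT =
    tab_cls k i * (\pi_(tab_alg k A) << m >>)%qT.
  rewrite /tab_cls -rmorphM; apply: congr1.
  by rewrite malgM_def fgmulUU mulr1.
apply: etrans (congr1 (linearization diam) piM) _.
apply: etrans (qsh_morphismM _ _ _) (etrans _ (esym h'E)).
exact: (congr2 (qsh diam) (linearization_tab diamC diamA i) hE).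
Qed.

Theorem theorem4 (k : comNzRingType) (A : countType)
    (diam : {bilinear {malg k[A]} -> {malg k[A]} -> {malg k[A]}})
    (P : comAlgType k) (d : Order.disp_t) (X : finOrderType d)
    (f : X -> {linear {malg k[A]} -> P}) :
  commutative diam -> associative diam ->
  (forall (m : X) (x y : {malg k[A]}), f m (diam x y) = f m x * f m y) ->
  exists F : {lrmorphism lin_alg diam -> P},
    (forall h : tableau A, F (lin_cls diam h) = schur f h) /\
    (forall G : {linear lin_alg diam -> P},
       (forall h : tableau A, G (lin_cls diam h) = schur f h) -> G =1 F).
Proof.
move=> diamC diamA fM.
pose ev := word_eval f (alphabet X).
have evl : plinear ev by exact: word_eval_plinear.
have [|||F0 F0E] := @exists_lrmorphism k (tab_alg k A) P
  (fun x => ev (linearization diam x)).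
- by move=> c x y; rewrite linearP; apply: evl.
- by rewrite qsh_morphism1 -word_nil; apply: word_eval1.
- by move=> x y; rewrite qsh_morphismM; apply: word_evalM.
(* [F0] factors through the linearization, so it descends to the quotient by its kernel. *)
have F0ker x : x \in ker_linearization diam -> F0 x = 0.
  by move=> /eqP Lx; rewrite F0E Lx; apply: plinear0.
have [F FE] := exists_quot_lift F0ker.
have Fcls h : F (lin_cls diam h) = schur f h.
  by rewrite /lin_cls FE F0E linearization_tab //; apply: word_eval_schur.
exists F; split=> // G GE x.
move: x; apply: (@plinear_ext k _ P _ _ _ _ (spans_lin_cls diamC diamA))
  => [c x y|c x y|h].
- by rewrite linearP.
- by rewrite linearP.
- by rewrite GE Fcls.
Qed.
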